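(* Let $E$ be a Banach space with a separable quotient and weak$^*$-separable dual, let $R\in\mathcal R_d(E)$, let $F$ be a Banach space, and let $T:E\to F$ be a bounded linear operator with proper dense range. Then there exists a closed infinite-codimensional subspace $X\subset E$ such that (1) $E/X$ is separable; (2) $R\cap X=\{0\}$; and (3) $T^*(F^* )\cap X^{\perp}=\{0\}$.
   Context: All spaces are real. A Banach space $E$ has a separable quotient if there is a closed subspace $N\subset E$ such that $E/N$ is infinite-dimensional and separable. A linear subspace $R\subset E$ is an operator range in $E$ if there exist a Banach space $G$ and a bounded linear operator $A:G\to E$ with $A(G)=R$. $\mathcal R_d(E)$ denotes the class of proper (i.e. $\neq E$) dense operator ranges in $E$. $T$ has proper dense range if $T(E)\neq F$ and $T(E)$ is dense in $F$. $T^*:F^*\to E^*$ is the adjoint of $T$, and $X^\perp=\{f\in E^*: f(x)=0 \text{ for all } x\in X\}$. *)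

(* Defs.v *)
From HB Require Import structures.
From mathcomp Require Import all_boot all_order all_algebra generic_quotient.
From mathcomp Require Import ring_quotient.
From mathcomp Require Import boolp classical_sets functions cardinality reals.
From mathcomp Require Import topology normedtype.

Set Implicit Arguments.
Unset Strict Implicit.
Unset Printing Implicit Defensive.

Import Order.TTheory GRing.Theory Num.Theory.
Import numFieldNormedType.Exports.

Local Open Scope classical_set_scope.
Local Open Scope ring_scope.

Definition separable (T : topologicalType) : Prop :=
  exists2 D : set T, countable D & dense D.

Definition finite_dimensional (R : realType) (V : lmodType R) : Prop :=
  exists (n : nat) (b : 'I_n -> V),
    forall v : V, exists c : 'I_n -> R, v = \sum_(i < n) c i *: b i.

Definition infinite_dimensional (R : realType) (V : lmodType R) : Prop :=
  ~ finite_dimensional V.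

Definition bounded_op (R : realType) (V W : normedModType R) (f : V -> W) :
    Prop :=
  exists M : R, forall x : V, `|f x| <= M * `|x|.

Lemma bounded_op_continuous (R : realType) (V W : normedModType R)
  (f : {linear V -> W}) : bounded_op f <-> continuous f.
Proof.
split=> [[M fM]|/linear_bounded_continuous/linear_boundedP].
  apply/linear_bounded_continuous/linear_boundedP.
  near=> r => x; apply: le_trans (fM x) _.
  by apply: ler_wpM2r => //; near: r; apply: nbhs_pinfty_ge; exact: num_real.
by move=> /pinfty_ex_gt0[M _ fM]; exists M.
Unshelve. all: by end_near. Qed.

Section QuotientSpace.
Variables (R : realType) (E : normedModType R).

Record closedSubspace := ClosedSubspace {
  closedSubspace_set :> set E;
  closedSubspace_submod : submod_closed (mem closedSubspace_set);
  closedSubspace_closed : closed closedSubspace_set }.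

Variable N : closedSubspace.

Local Notation inN := (closedSubspace_set N).

Lemma closedSubspace0 : inN 0.
Proof. by have [/set_mem] := closedSubspace_submod N. Qed.

Lemma closedSubspaceP (a : R) (x y : E) : inN x -> inN y -> inN (a *: x + y).
Proof.
move=> Nx Ny; have [_ NP] := closedSubspace_submod N.
by apply/set_mem/NP; exact/mem_set.
Qed.

Lemma closedSubspaceD (x y : E) : inN x -> inN y -> inN (x + y).
Proof. by move=> Nx Ny; rewrite -[x]scale1r; exact: closedSubspaceP. Qed.

Lemma closedSubspaceZ (a : R) (x : E) : inN x -> inN (a *: x).
Proof.
move=> Nx; rewrite -[_ *: _]addr0.
by apply: closedSubspaceP => //; exact: closedSubspace0.
Qed.

Lemma closedSubspaceN (x : E) : inN x -> inN (- x).
Proof. by move=> Nx; rewrite -scaleN1r; exact: closedSubspaceZ. Qed.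

Definition coset_eq (x y : E) : bool := `[< inN (x - y) >].

Lemma coset_eq_refl : reflexive coset_eq.
Proof. by move=> x; apply/asboolP; rewrite subrr; exact: closedSubspace0. Qed.

Lemma coset_eq_sym : symmetric coset_eq.
Proof.
by move=> x y; apply/asboolP/asboolP => /closedSubspaceN; rewrite opprB.
Qed.

Lemma coset_eq_trans : transitive coset_eq.
Proof.
move=> y x z /asboolP Nxy /asboolP Nyz; apply/asboolP.
by have := closedSubspaceD Nxy Nyz; rewrite addrA subrK.
Qed.

Canonical coset_equiv :=
  EquivRel coset_eq coset_eq_refl coset_eq_sym coset_eq_trans.

Local Open Scope quotient_scope.

Definition quotientSpace : Type := {eq_quot coset_eq}.

HB.instance Definition _ := Choice.on quotientSpace.
HB.instance Definition _ := EqQuotient.on quotientSpace.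

Local Notation Q := quotientSpace.

Lemma quotientSpace_eqP (x y : E) : reflect (x = y %[mod Q]) `[< inN (x - y) >].
Proof. exact: (@eqmodP E coset_equiv x y). Qed.

Definition quotient_zero : Q := lift_cst Q 0.
Definition quotient_opp := lift_op1 Q -%R.
Definition quotient_add := lift_op2 Q +%R.
Definition quotient_scale (a : R) := lift_op1 Q ( *:%R a).

Canonical pi_quotient_zero_morph := PiConst quotient_zero.

Lemma pi_quotient_opp : {morph \pi : x / - x >-> quotient_opp x}.
Proof.
move=> x; unlock quotient_opp; apply/quotientSpace_eqP/asboolP.
have /quotientSpace_eqP/asboolP/closedSubspaceN : x = repr (\pi_Q x) %[mod Q].
  by rewrite reprK.
by rewrite opprD.
Qed.
Canonical pi_quotient_opp_morph := PiMorph1 pi_quotient_opp.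

Lemma pi_quotient_add : {morph \pi : x y / x + y >-> quotient_add x y}.
Proof.
move=> x y; unlock quotient_add; apply/quotientSpace_eqP/asboolP.
have /quotientSpace_eqP/asboolP Nx : x = repr (\pi_Q x) %[mod Q].
  by rewrite reprK.
have /quotientSpace_eqP/asboolP Ny : y = repr (\pi_Q y) %[mod Q].
  by rewrite reprK.
by rewrite opprD addrACA; exact: closedSubspaceD.
Qed.
Canonical pi_quotient_add_morph := PiMorph2 pi_quotient_add.

Lemma pi_quotient_scale (a : R) :
  {morph \pi : x / a *: x >-> quotient_scale a x}.
Proof.
move=> x; unlock quotient_scale; apply/quotientSpace_eqP/asboolP.
rewrite -scalerBr; apply: closedSubspaceZ.
by apply/asboolP/quotientSpace_eqP; rewrite reprK.
Qed.
Canonical pi_quotient_scale_morph a := PiMorph1 (pi_quotient_scale a).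

Fact quotient_addA : associative quotient_add.
Proof. by do 3!elim/quotW=> ?; rewrite !piE addrA. Qed.
Fact quotient_addC : commutative quotient_add.
Proof. by do 2!elim/quotW=> ?; rewrite !piE addrC. Qed.
Fact quotient_add0 : left_id quotient_zero quotient_add.
Proof. by elim/quotW=> ?; rewrite !piE add0r. Qed.
Fact quotient_addN : left_inverse quotient_zero quotient_opp quotient_add.
Proof. by elim/quotW=> ?; rewrite !piE addNr. Qed.

HB.instance Definition _ := GRing.isZmodule.Build Q
  quotient_addA quotient_addC quotient_add0 quotient_addN.
HB.instance Definition _ :=
  @isZmodQuotient.Build E coset_eq 0 -%R +%R Q
    (lock _) pi_quotient_opp pi_quotient_add.

Fact quotient_scaleA a b q :
  quotient_scale a (quotient_scale b q) = quotient_scale (a * b) q.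
Proof. by elim/quotW: q => x; rewrite !piE scalerA. Qed.
Fact quotient_scale1 : left_id 1 quotient_scale.
Proof. by elim/quotW=> x; rewrite !piE scale1r. Qed.
Fact quotient_scaleDr : right_distributive quotient_scale +%R.
Proof. by move=> a; do 2!elim/quotW=> ?; rewrite !piE scalerDr. Qed.
Fact quotient_scaleDl q : {morph quotient_scale^~ q : a b / a + b}.
Proof. by move=> a b; elim/quotW: q => x; rewrite !piE scalerDl. Qed.

HB.instance Definition _ := GRing.Zmodule_isLmodule.Build R Q
  quotient_scaleA quotient_scale1 quotient_scaleDr quotient_scaleDl.

Lemma pi_quotientZ (a : R) (x : E) : \pi_Q (a *: x) = a *: \pi_Q x.
Proof. exact: pi_quotient_scale. Qed.

Lemma pi_quotientD (x y : E) : \pi_Q (x + y) = \pi_Q x + \pi_Q y.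
Proof. exact: pi_quotient_add. Qed.

Lemma pi_quotient0 : \pi_Q 0 = 0.
Proof. by rewrite pi_zeror. Qed.

Definition quotient_norm (q : Q) : R :=
  inf [set `|x| | x in [set x : E | \pi_Q x = q]].

Lemma quotient_norm_le (x : E) : quotient_norm (\pi_Q x) <= `|x|.
Proof.
apply: ge_inf; last by exists x.
by exists 0 => _ [y _ <-].
Qed.

Lemma le_quotient_norm (q : Q) (c : R) :
  (forall x, \pi_Q x = q -> c <= `|x|) -> c <= quotient_norm q.
Proof.
move=> cq; apply: lb_le_inf.
  by exists `|repr q|, (repr q) => //=; rewrite reprK.
by move=> _ [x xq <-]; exact: cq.
Qed.

Lemma quotient_norm_adherent (q : Q) (e : R) : 0 < e ->
  exists2 x, \pi_Q x = q & `|x| < quotient_norm q + e.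
Proof.
move=> e0; apply: contrapT => h.
suff : quotient_norm q + e <= quotient_norm q.
  by rewrite gerDl leNgt e0.
apply: le_quotient_norm => x xq; rewrite leNgt; apply/negP => xe.
by apply: h; exists x.
Qed.

Fact quotient_normD (p q : Q) :
  quotient_norm (p + q) <= quotient_norm p + quotient_norm q.
Proof.
rewrite -lerBlDr; apply: le_quotient_norm => x xp.
rewrite lerBlDr -lerBlDl; apply: le_quotient_norm => y yq.
rewrite lerBlDl -xp -yq -pi_quotientD.
exact: le_trans (quotient_norm_le _) (ler_normD _ _).
Qed.

Fact quotient_normZ (a : R) (q : Q) :
  quotient_norm (a *: q) = `|a| * quotient_norm q.
Proof.
have le b p : b != 0 -> quotient_norm (b *: p) <= `|b| * quotient_norm p.
  move=> b0; rewrite -ler_pdivrMl ?normr_gt0//.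
  apply: le_quotient_norm => x <-.
  by rewrite ler_pdivrMl ?normr_gt0// -normrZ -pi_quotientZ quotient_norm_le.
have [->|a0] := eqVneq a 0.
  rewrite scale0r normr0 mul0r; apply/eqP; rewrite eq_le; apply/andP; split.
    by rewrite -pi_quotient0 -(normr0 E) quotient_norm_le.
  by apply: le_quotient_norm => x _.
apply/eqP; rewrite eq_le le//= -ler_pdivlMl ?normr_gt0//.
have := le a^-1 (a *: q); rewrite scalerA mulVf// scale1r normfV; apply.
by rewrite invr_eq0.
Qed.

Fact quotient_norm0_eq0 (q : Q) : quotient_norm q = 0 -> q = 0.
Proof.
move=> q0; rewrite -[q]reprK -pi_quotient0.
apply/quotientSpace_eqP/asboolP; rewrite subr0.
apply: (@closedSubspace_closed N) => A /nbhs_ballP[e /= e0 eA].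
have [x xq] := quotient_norm_adherent q e0.
rewrite q0 add0r => xe; exists (repr q - x); split.
  by apply/asboolP/quotientSpace_eqP; rewrite reprK.
by apply: eA; rewrite -ball_normE /= opprB addrC subrK.
Qed.

HB.instance Definition _ := @Lmodule_isNormed.Build R Q
  quotient_norm quotient_normD quotient_normZ quotient_norm0_eq0.

End QuotientSpace.

Definition has_separable_quotient (R : realType) (E : normedModType R) : Prop :=
  exists N : closedSubspace E,
    infinite_dimensional (quotientSpace N) /\ separable (quotientSpace N).

Section Dual.
Variables (R : realType) (E : normedModType R).

Definition bounded_functional : {pred (E -> R^o)} :=
  [pred f | `[< linear f /\ bounded_op f >]].

Fact bounded_functional_submod : submod_closed bounded_functional.
Proof.
split=> [|a f g /asboolP[lf [M fM]] /asboolP[lg [M' gM']]]; apply/asboolP.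
  split; first by move=> a x y; rewrite /= scaler0 addr0.
  by exists 0 => x; rewrite normr0 mul0r.
split.
  move=> b x y; rewrite !fctE lf lg !scalerDr !scalerA (mulrC a).
  by rewrite addrACA.
exists (`|a| * M + M') => x; rewrite !fctE; apply: le_trans (ler_normD _ _) _.
by rewrite mulrDl normrZ -mulrA lerD// ler_wpM2l.
Qed.

HB.instance Definition _ :=
  GRing.isSubmodClosed.Build R (E -> R^o) bounded_functional
    bounded_functional_submod.

Record dual := Dual {
  dual_fun :> E -> R^o;
  dual_funP : dual_fun \in bounded_functional }.

HB.instance Definition _ := [isSub of dual for dual_fun].
HB.instance Definition _ := [Choice of dual by <:].
HB.instance Definition _ := [SubChoice_isSubLmodule of dual by <:].

(* the weak* topology on [dual]: pointwise convergence on [E] *)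
Definition weak_star : Type :=
  initial_topology (dual_fun : dual -> {ptws E -> R^o}).

HB.instance Definition _ := Topological.on weak_star.

Definition annihilator (X : set E) : set dual :=
  [set f | forall x, X x -> f x = 0].

End Dual.

Fact adjoint_subproof (R : realType) (E F : normedModType R)
    (T : {linear E -> F}) (bT : bounded_op T) (f : dual F) :
  (f : F -> R^o) \o T \in @bounded_functional R E.
Proof.
have /asboolP[lf [M fM]] := dual_funP f; have [M' TM'] := bT; apply/asboolP.
split; first by move=> a x y; rewrite /= linearP lf.
exists (`|M| * M') => x; apply: le_trans (fM _) _.
apply: (@le_trans _ _ (`|M| * `|T x|)).
  by rewrite ler_wpM2r// ler_norm.
by rewrite -mulrA ler_wpM2l.
Qed.

Definition adjoint (R : realType) (E F : normedModType R)
    (T : {linear E -> F}) (bT : bounded_op T) (f : dual F) : dual E :=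
  Dual (adjoint_subproof bT f).

Definition operator_range (R : realType) (E : normedModType R) (S : set E) :
    Prop :=
  exists (G : completeNormedModType R) (A : {linear G -> E}),
    bounded_op A /\ range A = S.

Definition proper_dense_operator_range (R : realType) (E : normedModType R)
    (S : set E) : Prop :=
  [/\ operator_range S, S <> setT & dense S].

Definition proper_dense_range (R : realType) (E F : normedModType R)
    (T : {linear E -> F}) : Prop :=
  range T <> setT /\ dense (range T).

(* Main.v *)
From HB Require Import structures.
Require Import Defs.
From mathcomp Require Import all_boot all_order all_algebra.
From mathcomp Require Import boolp classical_sets functions cardinality reals.
From mathcomp Require Import topology normedtype sequences.
From mathcomp Require Import ring lra.

(* Write S = A(G), and A', T' for the adjoints. One builds inductively a
   biorthogonal system (f_n, x_n) in E' x E and takes for X the common kernel of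
   the f_n.
   - If |A' f_n| |x_n| <= 2^-n, the series sum_n f_n(y) x_n converges for every
     y in S and y minus its sum lies in X; since S is dense, X and the x_n span
     a dense subspace, so E/X is separable, and a functional vanishing on X and
     on the x_n is zero.
   - If moreover |A' f_n - d_n A' g_tau(n)| <= d_n/(n+1) for some d_n > 0, where
     (g_i) is total and tau takes each value infinitely often, then every y in
     both S and X is killed by each g_i, so y = 0.
   - If for each n there is z_n with f_i(z_n) = f_i(x_tau(n)) for all i and
     |T z_n| <= 1/(n+1), then x_tau(n) - z_n is in X, so a functional T' phi
     vanishing on X vanishes on every x_j, hence is zero.
   Such z_n exist as soon as no nonzero combination of f_0, ..., f_n is in the
   range of T', and f_n can be chosen outside any given finite extension of that
   range because T(E) is not closed. The later f_m must vanish on x_n and z_n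
   while approximating multiples of the g_i on S; this is possible when x_n and
   z_n are in general position with respect to S, and such vectors exist because
   A' is not bounded below on the annihilator of the vectors already chosen.
   A separable quotient of E is thus obtained from S alone. *)

Set Implicit Arguments.
Unset Strict Implicit.
Unset Printing Implicit Defensive.

Import Order.TTheory GRing.Theory Num.Theory.
Import numFieldNormedType.Exports.

Local Open Scope classical_set_scope.
Local Open Scope ring_scope.

(** * The Hahn-Banach theorem and bounded functionals *)

Section HahnBanach.
Variables (R : realType) (E : lmodType R) (p : E -> R).
Hypothesis pD : forall x y, p (x + y) <= p x + p y.
Hypothesis pZ : forall a x, p (a *: x) = `|a| * p x.

Lemma seminorm_ge0 x : 0 <= p x.
Proof.
have p0 : p 0 = 0 by rewrite -(scale0r x) pZ normr0 mul0r.
have := pD x (- x); rewrite subrr p0 -scaleN1r pZ normrN1 mul1r; lra.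
Qed.

(** Partial linear functionals are encoded by their graphs. Single-valuedness comes from domination,
    as two values at one point differ by at most [p 0 = 0]. *)
Definition dominated_graph (A : set (E * R)) : Prop :=
  (forall a u v, A u -> A v -> A (a *: u.1 + v.1, a * u.2 + v.2)) /\
  (forall u, A u -> u.2 <= p u.1).

(** The value at [x1] must lie above every [u.2 - p (u.1 - x1)] and below every
    [p (v.1 + x1) - v.2]. The triangle inequality leaves room, and the supremum of the lower bounds
    serves. *)
Lemma dominated_graph_extend A x1 : A !=set0 -> dominated_graph A ->
  exists c, dominated_graph
    [set w | exists u t, A u /\ w = (u.1 + t *: x1, u.2 + t * c)].
Proof.
move=> [w0 Aw0] [Alin Adom].
have A0 : A (0, 0).
  by have := Alin (-1) _ _ Aw0 Aw0; rewrite scaleN1r mulN1r !addNr.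
have AZ a u : A u -> A (a *: u.1, a * u.2).
  by move=> Au; have := Alin a _ _ Au A0; rewrite /= !addr0.
pose V := [set u.2 - p (u.1 - x1) | u in A].
have Vub v : A v -> ubound V (p (v.1 + x1) - v.2).
  move=> Av _ [u Au <-]; have := Adom _ (Alin 1 _ _ Au Av).
  rewrite /= scale1r mul1r.
  have := pD (u.1 - x1) (v.1 + x1); rewrite addrACA (addrC _ x1) subrr addr0.
  lra.
have V0 : V !=set0 by exists (w0.2 - p (w0.1 - x1)), w0.
have hsV : has_sup V by split=> //; exists (p (w0.1 + x1) - w0.2); exact: Vub.
exists (sup V); split=> [a _ _ [u [t [Au ->]]] [v [s [Av ->]]]|_ [u [t [Au ->]]]] /=.
  exists (a *: u.1 + v.1, a * u.2 + v.2), (a * t + s); split; first exact: Alin.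
  congr pair => /=; last by ring.
  by rewrite scalerDr scalerA scalerDl addrACA.
have [t0|t0|->] := ltrgt0P t; last by rewrite scale0r mul0r !addr0; exact: Adom.
- have cu : sup V <= p (t^-1 *: u.1 + x1) - t^-1 * u.2.
    by apply: sup_le_ub => //; exact: (Vub _ (AZ t^-1 _ Au)).
  rewrite -[u.1](scalerKV (lt0r_neq0 t0)) -scalerDr pZ gtr0_norm//.
  rewrite -[u.2 in leLHS](mulVKf (lt0r_neq0 t0)) -mulrDr ler_pM2l//.
  by rewrite addrC -lerBrDr.
- have nt0 : 0 < - t by rewrite oppr_gt0.
  have cu : (- t)^-1 * u.2 - p ((- t)^-1 *: u.1 - x1) <= sup V.
    apply: ub_le_sup; first by case: hsV.
    by exists ((- t)^-1 *: u.1, (- t)^-1 * u.2) => //; exact: AZ.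
  have -> : u.1 + t *: x1 = (- t) *: ((- t)^-1 *: u.1 - x1).
    by rewrite scalerBr scalerKV ?lt0r_neq0// scaleNr opprK.
  have -> : u.2 + t * sup V = (- t) * ((- t)^-1 * u.2 - sup V).
    by rewrite mulrBr mulVKf ?lt0r_neq0// mulNr opprK.
  by rewrite pZ gtr0_norm// ler_pM2l//; lra.
Qed.

Lemma hahn_banach_seminorm (x0 : E) : exists f : E -> R^o,
  [/\ linear f, forall x, f x <= p x & f x0 = p x0].
Proof.
pose B0 := [set (t *: x0, t * p x0) | t in [set: R]].
have dB0 : dominated_graph B0.
  split=> [a _ _ [t _ <-] [s _ <-]|_ [t _ <-]] /=.
    by exists (a * t + s) => //; rewrite scalerA -scalerDl mulrA mulrDl.
  by rewrite pZ ler_wpM2r ?seminorm_ge0// ler_norm.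
(* Domination is asked of the union with [B0], so that the empty chain is no exception. *)
have [|A [dA Amax]] := @Zorn_bigcup _ [set A | dominated_graph (A `|` B0)].
  move=> C CP Ctot; split=> [a u v|u [[X CX Xu]|]]; last exact: dB0.2.
    have in1 X w : C X -> (X `|` B0) w -> (\bigcup_(Y in C) Y `|` B0) w.
      by move=> CX [Xw|]; [left; exists X | right].
    move=> [[X CX Xu]|Bu] [[Y CY Yv]|Bv].
    - have [XY|YX] := Ctot _ _ CX CY.
        by apply: (in1 Y) => //; apply: (CP _ CY).1; left => //; exact: XY.
      by apply: (in1 X) => //; apply: (CP _ CX).1; left => //; exact: YX.
    - by apply: (in1 X) => //; apply: (CP _ CX).1; [left|right].
    - by apply: (in1 Y) => //; apply: (CP _ CY).1; [right|left].
    - by right; exact: dB0.1.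
  by apply: (CP _ CX).2; left.
set M := A `|` B0 in dA.
have B0M : B0 `<=` M by move=> w; right.
have M0 : M (0, 0) by apply: B0M; exists 0 => //; rewrite scale0r mul0r.
have Mtot x : exists r, M (x, r).
  apply: contrapT => nx.
  have [c dM'] := dominated_graph_extend x (ex_intro _ _ M0) dA.
  set M' := [set w | _] in dM'.
  have MM' : M `<=` M'.
    by move=> [y r] My; exists (y, r), 0; rewrite scale0r mul0r !addr0.
  have M'x : M' (x, c) by exists (0, 0), 1; rewrite scale1r mul1r !add0r.
  apply: (Amax M').
    split=> [w Aw|M'A]; first by apply: MM'; left.
    by apply: nx; exists c; left; exact: M'A.
  rewrite /= (_ : M' `|` B0 = M')//.
  by apply/setUidPl => w /B0M /MM'.
have Mle x r s : M (x, r) -> M (x, s) -> r <= s.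
  move=> Mr Ms; have /dA.2 /= := dA.1 (-1) _ _ Ms Mr.
  have p0 : p 0 = 0 by rewrite -(scale0r x) pZ normr0 mul0r.
  by rewrite scaleN1r addNr p0 mulN1r addrC subr_le0.
have Muniq x r s : M (x, r) -> M (x, s) -> r = s.
  by move=> Mr Ms; apply/eqP; rewrite eq_le (Mle x r s)// (Mle x s r).
have /choice[f Mf] := Mtot.
exists f; split=> [a x y|x|]; last by apply: Muniq (Mf _) _; apply: B0M;
  exists 1 => //; rewrite scale1r mul1r.
- by apply: Muniq (Mf _) _; exact: (dA.1 a _ _ (Mf x) (Mf y)).
- exact: (dA.2 _ (Mf x)).
Qed.

End HahnBanach.

Section DualTheory.
Variables (R : realType) (E : normedModType R).

Fact dual_is_linear (f : dual E) : linear f.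
Proof. by have /asboolP[] := dual_funP f. Qed.

HB.instance Definition _ (f : dual E) :=
  GRing.isLinear.Build R E R^o *:%R (dual_fun f) (dual_is_linear f).

Lemma dual_bounded (f : dual E) :
  exists2 M : R, 0 < M & forall x, `|f x| <= M * `|x|.
Proof.
have /asboolP[_ [M fM]] := dual_funP f; exists (`|M| + 1) => [|x].
  by rewrite ltr_wpDl.
apply: le_trans (fM x) _; rewrite ler_wpM2r//.
by rewrite (le_trans (ler_norm M))// lerDl.
Qed.

Lemma exists_dual (f : E -> R^o) M : linear f -> (forall x, `|f x| <= M * `|x|) ->
  exists g : dual E, g =1 f.
Proof.
move=> lf fM.
have f_in : f \in @bounded_functional R E by apply/asboolP; split=> //; exists M.
by exists (Dual f_in).
Qed.

(* The structure on values is that of [R] rather than that of [R^o], which keeps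
   the rewriting lemmas on scalars applicable. *)
Lemma dualD (f g : dual E) x : (f + g) x = (f x : R) + g x :> R.
Proof. by []. Qed.

Lemma dualB (f g : dual E) x : (f - g) x = (f x : R) - g x :> R.
Proof. by []. Qed.

Lemma dualZ a (f : dual E) x : (a *: f) x = a * (f x : R) :> R.
Proof. by []. Qed.

Lemma dual_linearD (f : dual E) x y : f (x + y) = (f x : R) + f y :> R.
Proof. exact: linearD. Qed.

Lemma dual_linearB (f : dual E) x y : f (x - y) = (f x : R) - f y :> R.
Proof. exact: linearB. Qed.

Lemma dual_linearZ (f : dual E) a x : f (a *: x) = a * (f x : R) :> R.
Proof. exact: linearZ. Qed.

Lemma dual_linear0 (f : dual E) : f 0 = 0 :> R.
Proof. exact: linear0. Qed.

Lemma annihilator0 (V : set E) (f : dual E) x :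
  annihilator V f -> V x -> f x = 0 :> R.
Proof. by move=> fV /fV. Qed.

Lemma dualP (f g : dual E) : f =1 g -> f = g.
Proof. by move=> fg; apply: val_inj; apply: funext. Qed.

Lemma dual_continuous (f : dual E) : continuous (f : E -> R^o).
Proof.
apply: (bounded_op_continuous (f : {linear E -> R^o})).1.
by have [M _ fM] := dual_bounded f; exists M.
Qed.

Lemma hahn_banach_dual (p : E -> R) (C : R) (x0 : E) :
  (forall x y, p (x + y) <= p x + p y) ->
  (forall a x, p (a *: x) = `|a| * p x) -> (forall x, p x <= C * `|x|) ->
  exists f : dual E, (forall x, `|f x| <= p x) /\ f x0 = p x0.
Proof.
move=> pD pZ pC; have [f [lf fp fx0]] := hahn_banach_seminorm pD pZ x0.
have fN x : f (- x) = - f x.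
  by have := lf (-2) x x; rewrite scaleNr mulr2n scalerDl !scale1r opprD subrK => ->;
    rewrite /GRing.scale /=; lra.
have nfp x : `|f x| <= p x.
  by rewrite ler_norml fp andbT lerNl -fN -[p x]mul1r -normrN1 -pZ scaleN1r.
have [g gf] := exists_dual lf (fun x => le_trans (nfp x) (pC x)).
by exists g; split=> [x|]; rewrite gf.
Qed.

Lemma norming_dual (x0 : E) :
  exists f : dual E, (forall x, `|f x| <= `|x|) /\ f x0 = `|x0|.
Proof.
apply: (@hahn_banach_dual Num.norm 1) => [x y|a x|x].
- exact: ler_normD.
- exact: normrZ.
- by rewrite mul1r.
Qed.

End DualTheory.

(** * Vectors in general position with respect to a dense operator range *)

Section Preliminaries.
Variable R : realType.

Lemma ler_mul_shrink (e k : R) : 0 <= e -> 0 <= k -> k * (e / (k + 1)) <= e.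
Proof.
by move=> e0 k0; rewrite mulrA ler_pdivrMr ?ltr_wpDl// mulrC ler_wpM2l// lerDl.
Qed.

Lemma dense_approx (V : normedModType R) (D : set V) x e :
  dense D -> 0 < e -> exists2 y, D y & `|x - y| < e.
Proof.
move=> dD e0; have [|y [xy Dy]] := dD (ball x e) _ (ball_open x e).
  by exists x; exact: ballxx.
by exists y => //; move: xy; rewrite -ball_normE.
Qed.

Lemma geometric_cvg_series (V : completeNormedModType R) (u : nat -> V) C q :
  0 <= q < 1 -> (forall n, `|u n| <= C * q ^+ n) -> cvgn (series u).
Proof.
move=> /andP[q0 q1] uC; apply: normed_cvg.
apply: (@series_le_cvg R _ (geometric C q)) => [n|n|n|] //=.
- exact: le_trans (uC n).
- by apply: is_cvg_geometric_series; rewrite ger0_norm.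
Qed.

(** This is the iteration of the open mapping theorem: each correction halves the remainder, and the
    corrections form a convergent series in [G]. *)
Lemma approx_surjective (G : completeNormedModType R) (E : normedModType R)
    (A : {linear G -> E}) M : bounded_op A ->
  (forall x, exists a, `|a| <= M * `|x| /\ `|x - A a| <= `|x| / 2) ->
  range A = setT.
Proof.
move=> /bounded_op_continuous cA /choice[sel selP].
apply/seteqP; split=> // x _.
pose r n := iter n (fun y => y - A (sel y)) x.
have rx n : `|r n| <= `|x| * 2^-1 ^+ n.
  elim: n => [|n ih]; first by rewrite expr0 mulr1.
  rewrite /= (le_trans (selP _).2)// exprSr mulrA.
  by rewrite ler_pM2r ?invr_gt0.
have half01 : 0 <= (2^-1 : R) < 1 by rewrite invr_ge0 ler0n/= invf_lt1// ltr1n.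
have cs : cvgn (series (sel \o r)).
  apply: (@geometric_cvg_series _ _ (`|M| * `|x|) 2^-1) => // n.
  rewrite /= (le_trans (selP _).1)// -mulrA.
  apply: le_trans (ler_wpM2r (normr_ge0 _) (ler_norm M)) _.
  exact: ler_wpM2l.
have Ar n : A (series (sel \o r) n) = x - r n.
  elim: n => [|n ih].
    by rewrite seriesEnat /= big_geq// linear0 subrr.
  by rewrite seriesSr /= linearD ih /= opprB addrA addrAC.
exists (limn (series (sel \o r))) => //.
have r0 : r n @[n --> \oo] --> (0 : E).
  apply/norm_cvg0P.
  apply: (@squeeze_cvgr _ _ _ _ (cst 0) (geometric `|x| 2^-1)).
  - by near=> n; rewrite normr_ge0 /= rx.
  - exact: cvg_cst.
  - by apply: cvg_geometric; rewrite ger0_norm//; case/andP: half01.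
have h1 : A (series (sel \o r) n) @[n --> \oo] --> A (limn (series (sel \o r))).
  by apply: (continuous_cvg _ (cA _)).
have h2 : A (series (sel \o r) n) @[n --> \oo] --> x.
  rewrite (funext Ar) -[nbhs x](congr1 (@nbhs E E) (subr0 x)).
  by apply: cvgB => //; exact: cvg_cst.
exact: cvg_unique h1 h2.
Unshelve. all: by end_near. Qed.

End Preliminaries.

Section DenseRange.
Variables (R : realType) (E G : completeNormedModType R) (A : {linear G -> E}).
Hypotheses (bA : bounded_op A) (dA : dense (range A)).

(* Equivalently, [v] is in the closure of [span V + A (ball 0 r)] for some [r]. *)
Definition small (V : set E) (v : E) : Prop := exists C : R,
  forall h, annihilator V h -> (forall a, `|h (A a)| <= `|a|) -> `|h v| <= C.

Lemma small_lin V c u v : small V u -> small V v -> small V (c *: u + v).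
Proof.
move=> [C uC] [D vD]; exists (`|c| * C + D) => h hV hA.
rewrite dual_linearD dual_linearZ; apply: le_trans (ler_normD _ _) _.
by apply: lerD; [rewrite normrM ler_wpM2l// uC|exact: vD].
Qed.

(** Take a functional that exceeds [e^-1] at [v] and divide it by its value there. *)
Lemma not_small_dual V v : ~ small V v -> forall e, 0 < e ->
  exists r, [/\ annihilator V r, r v = 1 & forall a, `|r (A a)| <= e * `|a|].
Proof.
move=> nv e e0; move/forallNP : nv => /(_ e^-1)/existsNP[h]/not_implyP[hV].
move=> /not_implyP[hA] /negP; rewrite -ltNge => hv.
have hv0 : h v != 0.
  by rewrite -normr_gt0; apply: lt_trans hv; rewrite invr_gt0.
exists ((h v)^-1 *: h); split=> [x Vx||a]; rewrite dualZ.
- by rewrite (annihilator0 hV Vx) mulr0.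
- by rewrite mulVf.
- rewrite normrM; apply: ler_pM => //.
  by rewrite normfV invf_ple ?posrE ?normr_gt0//; exact: ltW.
Qed.

(** General position for finite sets. A functional is made to vanish at one more vector [v] by
    subtracting a multiple of the [r] of [not_small_dual], at arbitrarily small cost along [A]. *)
Inductive admissible : set E -> Prop :=
| admissible0 : admissible set0
| admissibleU V v : admissible V -> ~ small V v -> admissible (V `|` [set v]).

Lemma annihilatorU V v (h : dual E) :
  annihilator (V `|` [set v]) h <-> annihilator V h /\ h v = 0 :> R.
Proof.
split=> [hVv|[hV hv] x [/hV//|->//]].
by split=> [x Vx|]; apply: hVv; [left|right].
Qed.

(** In the induction [r] is chosen after [p], so its bound along [A] can absorb the factor [p v]. *)
Lemma admissible_approx V (g : dual E) e : admissible V -> 0 < e ->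
  exists2 p, annihilator V p & forall a, `|p (A a) - g (A a)| <= e * `|a|.
Proof.
move=> aV; elim: aV e => {V} [|V v _ IH nv] e e0.
  by exists g => // a; rewrite subrr normr0 mulr_ge0// ltW.
have [p pV pg] := IH _ (divr_gt0 e0 (ltr0n R 2)).
have k0 : 0 < `|p v| + 1 by rewrite ltr_wpDl.
have [r [rV rv rA]] := not_small_dual nv (divr_gt0 (divr_gt0 e0 (ltr0n R 2)) k0).
exists (p - p v *: r) => [|a].
  apply/annihilatorU; split=> [x Vx|]; rewrite dualB dualZ ?rv ?mulr1 ?subrr//.
  by rewrite (annihilator0 pV Vx) (annihilator0 rV Vx) mulr0 subrr.
rewrite dualB dualZ addrAC; apply: le_trans (ler_normB _ _) _.
rewrite [e in leRHS]splitr mulrDl lerD// normrM.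
apply: le_trans (ler_wpM2l (normr_ge0 _) (rA a)) _.
by rewrite mulrA ler_wpM2r// ler_mul_shrink// ltW// divr_gt0.
Qed.

(** Here the correcting functionals are fixed before [e], and on their common kernel the correction
    is invisible. *)
Lemma admissible_finite_codim V : admissible V -> exists rs : seq (dual E),
  forall e : dual E, exists2 e' : dual E, annihilator V e' &
    forall z, (forall r, r \in rs -> r z = 0) -> e' z = e z.
Proof.
elim=> {V} [|V v _ [rs IH] nv]; first by exists [::] => e; exists e.
have [r [rV rv _]] := not_small_dual nv ltr01.
exists (r :: rs) => e; have [e' eV e'e] := IH e.
exists (e' - e' v *: r) => [|z zrs].
  apply/annihilatorU; split=> [x Vx|]; rewrite dualB dualZ ?rv ?mulr1 ?subrr//.
  by rewrite (annihilator0 eV Vx) (annihilator0 rV Vx) mulr0 subrr.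
rewrite dualB dualZ (zrs r) ?mem_head// mulr0 subr0; apply: e'e => s srs.
by apply: zrs; rewrite in_cons srs orbT.
Qed.

(** The adjoint of [A] is not bounded below on the annihilator of [V]. Uniformity of [B] in [e] is
    what allows one more vector to be added to [V]. *)
Definition unnorming (V : set E) : Prop := exists B : R, forall e, 0 < e ->
  exists (h : dual E) (x : E), [/\ annihilator V h, `|x| <= 1 /\ 1 <= h x,
    forall y, `|h y| <= B * `|y| & forall a, `|h (A a)| <= e * `|a|].

(** For empty [V], the failure of [approx_surjective] with constant [e^-1] is turned into a
    functional by Hahn-Banach. Each further vector is paid for by a larger [B]. *)
Lemma admissible_unnorming V : range A <> setT -> admissible V -> unnorming V.
Proof.
move=> AnT; elim=> {V} [|V v _ [B IH] nv].
  exists 2 => e e0.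
  have [x xA] : exists x, forall a, `|a| <= e^-1 * `|x| -> `|x| / 2 < `|x - A a|.
    apply: contrapT => /forallNP nx; apply: AnT.
    apply: (approx_surjective (M := e^-1) bA) => x.
    have /existsNP[a /not_implyP[aM /negP]] := nx x; rewrite -leNgt => xa.
    by exists a.
  have x0 : x != 0.
    apply/eqP => x0; have := xA 0.
    by rewrite x0 !normr0 linear0 subrr normr0 mulr0 lexx mul0r ltxx => /(_ isT).
  (* the infimum over [a] of [n y a] is a seminorm; as [A] is not open, it is large
     at some [x] *)
  pose n y a := e * `|a| + 2 * `|y - A a|.
  have n0 y a : 0 <= n y a by rewrite addr_ge0// mulr_ge0// ltW.
  pose p y := inf (range (n y)).
  have pn y a : p y <= n y a.
    by apply: ge_inf; [exists 0 => _ [b _ <-]|exists a].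
  have lep y c : (forall a, c <= n y a) -> c <= p y.
    move=> cn; apply: lb_le_inf; first by exists (n y 0), 0.
    by move=> _ [a _ <-].
  have pD y z : p (y + z) <= p y + p z.
    rewrite -lerBlDr; apply: (lep _ _) => a; rewrite lerBlDr -lerBlDl.
    apply: (lep _ _) => b; rewrite lerBlDl (le_trans (pn _ (a + b)))// /n.
    rewrite linearD opprD (addrACA y) [leRHS]addrACA -!mulrDr.
    by rewrite lerD// ler_wpM2l ?ler_normD// ltW.
  have pZle c y : c != 0 -> p (c *: y) <= `|c| * p y.
    move=> c0; rewrite -ler_pdivrMl ?normr_gt0//; apply: (lep _ _) => a.
    rewrite ler_pdivrMl ?normr_gt0// (le_trans (pn _ (c *: a)))// /n.
    by rewrite linearZ -scalerBr !normrZ mulrDr !(mulrCA `|c|).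
  have p0 : p 0 = 0.
    apply/eqP; rewrite eq_le lep// andbT (le_trans (pn _ 0))// /n.
    by rewrite linear0 subrr !normr0 !mulr0 addr0.
  have pZ c y : p (c *: y) = `|c| * p y.
    have [->|c0] := eqVneq c 0; first by rewrite scale0r p0 normr0 mul0r.
    apply/eqP; rewrite eq_le pZle//= -ler_pdivlMl ?normr_gt0//.
    have := pZle c^-1 (c *: y); rewrite scalerA mulVf// scale1r normfV; apply.
    by rewrite invr_eq0.
  have p2 y : p y <= 2 * `|y|.
    by rewrite (le_trans (pn _ 0))// /n normr0 mulr0 add0r linear0 subr0.
  have [h [hp hx]] := hahn_banach_dual x pD pZ p2.
  exists h, (`|x|^-1 *: x); split=> [//||y|a].
  - rewrite normrZ normfV normr_id mulVf ?normr_eq0//; split=> //.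
    rewrite dual_linearZ hx ler_pdivlMl ?normr_gt0// mulr1.
    apply: (lep _ _) => a; rewrite /n; have [/xA xa|ax] := leP `|a| (e^-1 * `|x|).
      by have := mulr_ge0 (ltW e0) (normr_ge0 a); lra.
    by rewrite ler_wpDr ?mulr_ge0// -ler_pdivrMl// ltW.
  - exact: le_trans (hp y) (p2 y).
  - rewrite (le_trans (hp _))// (le_trans (pn _ a))// /n.
    by rewrite subrr normr0 mulr0 addr0.
(* subtract from [h] its value at [v], which is small because [v] is close to the
   range of [A], on which [h] is small *)
have [r [rV rv rA]] := not_small_dual nv ltr01.
have [K K0 rK] := dual_bounded r.
exists (2 * (`|B| + K)) => e e0.
(* [t] will bound [h v]: being at most [e / 4] it keeps the corrected functional small along [A],
   and [t * K <= 1 / 2] keeps its value at [x] at least [1 / 2]. *)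
pose t := Num.min (e / 4) (1 / (K + K + 1)).
have K2 : 0 < K + K + 1 by rewrite addr_gt0// addr_gt0.
have t0 : 0 < t by rewrite lt_min !divr_gt0.
have te : t <= e / 4 by rewrite ge_min lexx.
have tK : t * (K + K + 1) <= 1 by rewrite -ler_pdivlMr// ge_min lexx orbT.
have [_ [a _ <-] /ltW va] : exists2 y, range A y & `|v - y| < t / 2 / (`|B| + 1).
  by apply: dense_approx => //; rewrite !divr_gt0// ltr_wpDl.
pose et := Num.min (e / 4) (t / 2 / (`|a| + 1)).
have et0 : 0 < et by rewrite lt_min !divr_gt0// ltr_wpDl.
have ete : et <= e / 4 by rewrite ge_min lexx.
have [h [x [hV [x1 hx] hB hA]]] := IH _ et0.
have hvt : `|h v : R| <= t.
  have -> : h v = h (v - A a) + h (A a) by rewrite -dual_linearD subrK.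
  apply: le_trans (ler_normD _ _) _; rewrite [leRHS]splitr lerD//.
    apply: le_trans (hB _) _; apply: le_trans (ler_wpM2r (normr_ge0 _) (ler_norm B)) _.
    apply: le_trans (ler_wpM2l (normr_ge0 _) va) _.
    by rewrite ler_mul_shrink// divr_ge0// ltW.
  apply: le_trans (hA _) _; rewrite mulrC.
  apply: le_trans (ler_mul_shrink (e := t / 2) _ (normr_ge0 a)).
    by rewrite ler_wpM2l// ge_min lexx orbT.
  by rewrite divr_ge0// ltW.
have rx : `|(h v : R) * r x| <= t * K.
  rewrite normrM ler_pM// (le_trans (rK _))//.
  by rewrite -[leRHS]mulr1 ler_wpM2l// ltW.
(* The factor 2 brings the value at [x] back to at least 1. *)
exists (2 *: (h - h v *: r)), x; split=> [|||b].
- apply/annihilatorU; split=> [y Vy|]; rewrite dualZ dualB dualZ.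
    by rewrite (annihilator0 hV Vy) (annihilator0 rV Vy) mulr0 subrr mulr0.
  by rewrite rv mulr1 subrr mulr0.
- split=> //; rewrite dualZ dualB dualZ.
  have := ler_norm ((h v : R) * r x); lra.
- move=> y; rewrite dualZ dualB dualZ normrM ger0_norm// -mulrA ler_wpM2l//.
  apply: le_trans (ler_normB _ _) _; rewrite mulrDl lerD//.
    by apply: le_trans (hB y) _; rewrite ler_wpM2r// ler_norm.
  rewrite normrM; apply: le_trans (ler_wpM2l (normr_ge0 _) (rK y)) _.
  rewrite mulrA ler_wpM2r//; apply: le_trans (ler_wpM2r (ltW K0) hvt) _.
  by nra.
- rewrite dualZ dualB dualZ normrM ger0_norm//.
  have hb := hA b; have rb := rA b; rewrite mul1r in rb.
  have hrb : `|(h v : R) * r (A b)| <= e / 4 * `|b|.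
    by rewrite normrM ler_pM// (le_trans hvt).
  have := ler_normB (h (A b) : R) ((h v : R) * r (A b)).
  have : et * `|b| <= e / 4 * `|b| by rewrite ler_wpM2r.
  by lra.
Qed.

(** If every vector were small, Banach-Steinhaus would bound uniformly all functionals that vanish
    on [V] and have norm at most 1 along [A]. Rescaled functionals from [unnorming] exceed any such
    bound. *)
Lemma admissible_not_small V : range A <> setT -> admissible V ->
  exists v, ~ small V v.
Proof.
move=> AnT /(admissible_unnorming AnT)[B VB]; apply/existsNP => smallV.
pose H := [set (h : E -> R^o) | h in
  [set h | annihilator V h /\ forall a, `|h (A a)| <= `|a|]].
have [_ [h _ <-]|v|M HM] := @Banach_Steinhauss _ E R^o H _ _ 1.
- split; last exact: dual_is_linear.
  have [K K0 hK] := dual_bounded h.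
  by move=> r; exists (K * r) => x xr; rewrite (le_trans (hK x))// ler_wpM2l// ltW.
- have [C vC] := smallV v; exists C => _ [h [hV hA] <-]; exact: vC.
have M1 : 0 < `|M| + 1 by rewrite ltr_wpDl.
have e0 : 0 < (`|M| + 1)^-1 by rewrite invr_gt0.
have [h [x [hV [x1 hx] _ hA]]] := VB _ e0.
have Hh : H ((`|M| + 1) *: h).
  exists ((`|M| + 1) *: h) => //; split=> [y Vy|a].
    by rewrite dualZ (annihilator0 hV Vy) mulr0.
  rewrite dualZ normrM gtr0_norm//.
  by apply: le_trans (ler_wpM2l (ltW M1) (hA a)) _; rewrite mulVKf// gt_eqF.
have := HM _ Hh x x1; rewrite dualZ normrM gtr0_norm//.
have := ler_norm (h x : R); have := ler_norm M; have := normr_ge0 M; nra.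
Qed.

End DenseRange.

(** * Functionals that are not dominated by an operator with dense range *)

Section ClosedSubspaces.
Variables (R : realType) (F : normedModType R).

Lemma closure_approx (C : set F) y e :
  closure C y -> 0 < e -> exists2 c, C c & `|y - c| < e.
Proof.
move=> Cy e0; have [c [Cc yc]] := Cy _ (nbhsx_ballx y e e0).
by exists c => //; move: yc; rewrite -ball_normE.
Qed.

Lemma closed_dense_setT (C : set F) : closed C -> dense C -> C = setT.
Proof.
move=> cC dC; apply/seteqP; split=> // x _; apply: cC => U.
move=> /nbhs_ballP[e /= e0 eU]; have [c Cc xc] := dense_approx x dC e0.
by exists c; split=> //; apply: eU; rewrite -ball_normE.
Qed.

(** For [v] outside [N], Hahn-Banach in the quotient gives a bounded [r] with [r v = 1] that
    vanishes on [N]. The sum is then the preimage of [N] under the continuous map [y - r y *: v]. *)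
Lemma closed_add_line (N : closedSubspace F) v :
  closed [set y | exists c t, closedSubspace_set N c /\ y = c + t *: v].
Proof.
have [Nv|nNv] := pselect (closedSubspace_set N v).
  rewrite (_ : [set y | _] = closedSubspace_set N); first exact: closedSubspace_closed.
  apply/seteqP; split=> [_ [c [t [Nc ->]]]|y Ny] /=.
    by apply: closedSubspaceD => //; exact: closedSubspaceZ.
  by exists y, 0; rewrite scale0r addr0.
pose pi := \pi_(quotientSpace N)%qT : F -> quotientSpace N.
have [f [f1 fv]] := norming_dual (pi v).
have v0 : `|pi v| != 0.
  rewrite normr_eq0; apply/eqP; rewrite /pi -(pi_quotient0 N).
  by move=> /quotientSpace_eqP/asboolP; rewrite subr0.
have lfpi : linear (fun y => f (pi y) : R^o).
  by move=> a x y; rewrite /pi pi_quotientD pi_quotientZ linearP.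
have fpi1 y : `|f (pi y)| <= 1 * `|y|.
  by rewrite mul1r (le_trans (f1 _))// quotient_norm_le.
have [g gE] := exists_dual lfpi fpi1.
pose r := `|pi v|^-1 *: g.
have rv : r v = 1 :> R by rewrite dualZ gE fv mulVf.
have rN c : closedSubspace_set N c -> r c = 0 :> R.
  move=> Nc; rewrite dualZ gE (_ : pi c = 0) ?dual_linear0 ?mulr0//.
  rewrite /pi -(pi_quotient0 N); apply/quotientSpace_eqP/asboolP.
  by rewrite subr0.
clearbody r.
rewrite (_ : [set y | _] = (fun y => y - r y *: v) @^-1` N).
  apply: (continuous_closedP _).1 (@closedSubspace_closed _ _ N) => y.
  apply: cvgB; first exact: cvg_id.
  by apply: cvgZl; exact: dual_continuous.
apply/seteqP; split=> [_ [c [t [Nc ->]]]|y Ny] /=.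
  by rewrite dual_linearD dual_linearZ rv rN// mulr1 add0r addrK.
by exists (y - r y *: v), (r y); rewrite subrK.
Qed.

End ClosedSubspaces.

Section NotBoundedBelow.
Variables (R : realType) (E F : completeNormedModType R) (T : {linear E -> F}).
Hypotheses (bT : bounded_op T) (dT : dense (range T)) (TnT : range T <> setT).

Definition common_kernel (rs : seq (dual E)) : set E :=
  [set z | forall r, r \in rs -> r z = 0 :> R].

Lemma common_kernel_lin rs a x y :
  common_kernel rs x -> common_kernel rs y -> common_kernel rs (a *: x + y).
Proof.
move=> xr yr r rrs; rewrite dual_linearD dual_linearZ.
by rewrite xr// yr// mulr0 addr0.
Qed.

Lemma common_kernel_nil : common_kernel [::] = setT.
Proof. by apply/seteqP; split=> // z _ r; rewrite in_nil. Qed.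

Lemma common_kernel_cons r rs z :
  common_kernel (r :: rs) z <-> r z = 0 :> R /\ common_kernel rs z.
Proof.
split=> [zr|[rz zr] s]; first split=> [|s srs]; try by apply: zr;
  rewrite ?mem_head// in_cons srs orbT.
by rewrite in_cons => /orP[/eqP ->//|/zr].
Qed.

Lemma closed_common_kernel rs : closed (common_kernel rs).
Proof.
elim: rs => [|r rs IH]; first by rewrite common_kernel_nil; exact: closedT.
rewrite (_ : common_kernel _ = (r : E -> R^o) @^-1` [set 0] `&` common_kernel rs).
  apply: closedI => //; apply: (continuous_closedP _).1.
    exact: dual_continuous.
  exact: closed_eq.
by apply/seteqP; split=> z /common_kernel_cons.
Qed.

(** Otherwise the functionals could be dropped one at a time, each enlarging the image by at most a
    line and so keeping it closed, until [range T] itself were closed, hence everything by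
    density. *)
Lemma image_common_kernel_not_closed rs : ~ closed (T @` common_kernel rs).
Proof.
elim: rs => [|r rs IH] cT.
  by apply: TnT; apply: closed_dense_setT => //; rewrite -common_kernel_nil.
apply: IH.
have [[x [xrs rx]]|rs0] :=
  pselect (exists x, common_kernel rs x /\ r x != 0); last first.
  rewrite (_ : common_kernel rs = common_kernel (r :: rs))//.
  apply/seteqP; split=> z => [zrs|/common_kernel_cons[]//].
  apply/common_kernel_cons; split=> //; apply: contrapT => /eqP rz.
  by apply: rs0; exists z.
have sN : submod_closed (mem (T @` common_kernel (r :: rs))).
  split=> [|a _ _ /set_mem[y yr <-] /set_mem[z zr <-]]; apply/mem_set.
    by exists 0; rewrite ?linear0// => s _; exact: dual_linear0.
  by exists (a *: y + z); [exact: common_kernel_lin|exact: linearP].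
have := @closed_add_line _ _ (ClosedSubspace sN cT) (T x).
rewrite (_ : [set y | _] = T @` common_kernel rs)//.
apply/seteqP; split=> [_ [_ [t [[z zr <-] ->]]]|_ [z zr <-]].
  exists (t *: x + z); last by rewrite linearP addrC.
  by apply: common_kernel_lin => //; have /common_kernel_cons[] := zr.
pose t := (r x : R)^-1 * r z.
exists (T (z - t *: x)), t; split; last by rewrite linearB linearZ subrK.
exists (z - t *: x) => //; apply/common_kernel_cons; split.
  by rewrite dual_linearB dual_linearZ mulrAC mulVf// mul1r subrr.
by rewrite addrC -scaleNr; exact: common_kernel_lin.
Qed.

(** Preimages of a rapidly converging sequence are Cauchy by the lower bound, and their limit stays
    in [Z]. *)
Lemma closed_image_bounded_below (Z : set E) e : closed Z -> 0 < e ->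
  (forall a x y, Z x -> Z y -> Z (a *: x + y)) ->
  (forall z, Z z -> e * `|z| <= `|T z|) -> closed (T @` Z).
Proof.
move=> cZ e0 Zlin Ze y cy.
have /choice[z zP] : forall n, exists z, Z z /\ `|y - T z| < 2^-1 ^+ n.
  move=> n; have [|_ [z Zz <-] yz] := closure_approx cy (e := 2^-1 ^+ n); last by exists z.
  by rewrite exprn_gt0// invr_gt0.
pose u n := z n.+1 - z n.
have su n : series u n = z n - z 0%N.
  elim: n => [|n ih]; first by rewrite seriesEnat /= big_geq// subrr.
  by rewrite seriesSr ih /u addrC addrA subrK.
have cu : cvgn (series u).
  apply: (@geometric_cvg_series _ _ _ (2 / e) 2^-1) => [|n].
    by rewrite invr_ge0 ler0n/= invf_lt1// ltr1n.
  rewrite mulrAC ler_pdivlMr// mulrC.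
  apply: le_trans (Ze _ _) _.
    by rewrite /u addrC -scaleN1r; apply: Zlin; exact: (zP _).1.
  rewrite linearB /=; have := (zP n).2; have := (zP n.+1).2.
  have -> : T (z n.+1) - T (z n) = (y - T (z n)) - (y - T (z n.+1)).
    by rewrite opprB [RHS]addrC addrA subrK.
  have := ler_normB (y - T (z n)) (y - T (z n.+1)).
  have : 0 <= (2^-1 : R) ^+ n by rewrite exprn_ge0// invr_ge0.
  rewrite exprS; lra.
have zl : z n @[n --> \oo] --> limn (series u) + z 0%N.
  rewrite [X in X @ _](_ : z = fun n => series u n + z 0%N); last first.
    by apply/funext => n; rewrite su subrK.
  by apply: cvgD; [exact: cu|exact: cvg_cst].
exists (limn (series u) + z 0%N).
  by apply: (closed_cvg Z cZ _ _ zl); apply: nearW => n; exact: (zP n).1.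
have h1 : T (z n) @[n --> \oo] --> T (limn (series u) + z 0%N).
  exact: (continuous_cvg _ ((bounded_op_continuous T).1 bT _)).
have h2 : T (z n) @[n --> \oo] --> y.
  apply/cvgrPdist_lt => d d0.
  have : (geometric 1 2^-1 : nat -> R) n @[n --> \oo] --> 0.
    by apply: cvg_geometric; rewrite ger0_norm ?invr_ge0// invf_lt1// ltr1n.
  move=> /cvgr0Pnorm_lt/(_ _ d0); apply: filterS => n /=.
  rewrite mul1r ger0_norm ?exprn_ge0 ?invr_ge0//.
  by apply: lt_trans; exact: (zP n).2.
exact: cvg_unique h1 h2.
Unshelve. all: by end_near. Qed.

(** Otherwise [T] would be bounded below on the common kernel, whose image would then be closed. *)
Lemma exists_small_image rs e : 0 < e ->
  exists z, [/\ common_kernel rs z, `|z| = 1 & `|T z| < e].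
Proof.
move=> e0; apply: contrapT => nz; apply: (@image_common_kernel_not_closed rs).
apply: (closed_image_bounded_below (e := e)) => //.
- exact: closed_common_kernel.
- exact: common_kernel_lin.
move=> z zr; rewrite leNgt; apply/negP => Tz; apply: nz.
have z0 : 0 < `|z| by rewrite normr_gt0; apply: contraTneq Tz => ->;
  rewrite linear0 !normr0 mulr0 ltxx.
exists (`|z|^-1 *: z); split.
- rewrite -[_ *: z]addr0; apply: common_kernel_lin => // r _.
  exact: dual_linear0.
- by rewrite normrZ normfV normr_id mulVf ?gt_eqF.
- by rewrite linearZ /= normrZ normfV normr_id ltr_pdivrMl// mulrC.
Qed.

(** On [common_kernel rs] this amounts, by Hahn-Banach, to [e] lying in the range of the adjoint of
    [T] plus the span of [rs]. *)
Definition dominated_on (Z : set E) (e : dual E) : Prop :=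
  exists C : R, forall z, Z z -> `|e z| <= C * `|T z|.

(** On unit vectors [z n] where [T] is far smaller than [3^-1 ^+ n], a signed sum of the
    [3^-1 ^+ n *: f n] keeps size at least [3^-1 ^+ n / 2], which defeats every constant. *)
Lemma exists_not_dominated rs : exists e, ~ dominated_on (common_kernel rs) e.
Proof.
have q0 n : 0 < (3^-1 : R) ^+ n by rewrite exprn_gt0// invr_gt0.
have /choice[z zP] : forall n : nat, exists z, [/\ common_kernel rs z, `|z| = 1 &
    `|T z| < 3^-1 ^+ n / (2 * n.+1%:R)].
  by move=> n; apply: exists_small_image; rewrite divr_gt0// mulr_gt0.
have /choice[f fP] : forall n, exists f : dual E,
    (forall x, `|f x| <= `|x|) /\ f (z n) = `|z n|.
  by move=> n; exact: norming_dual.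
have f1 n x : `|f n x : R| <= `|x| by have [] := fP n.
have fz n : f n (z n) = 1 :> R by have [_ ->] := fP n; have [] := zP n.
(* a gliding hump: each sign is chosen so that the [n]-th term does not cancel
   the previous ones at [z n], and the tail is too small to matter *)
pose step n (s : dual E) : dual E :=
  if 3^-1 ^+ n <= `|(s + 3^-1 ^+ n *: f n) (z n) : R|
  then s + 3^-1 ^+ n *: f n else s - 3^-1 ^+ n *: f n.
pose S := fix S n := if n is m.+1 then step m (S m) else 0 : dual E.
have Sz n : 3^-1 ^+ n <= `|S n.+1 (z n) : R|.
  rewrite /= /step; case: ifPn => //; rewrite -ltNge.
  rewrite dualD dualB !dualZ fz mulr1.
  by have := q0 n; rewrite ltr_norml ler_normr; lra.
have SS n x : `|(S n.+1 x : R) - S n x| <= 3^-1 ^+ n * `|x|.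
  have fq : `|3^-1 ^+ n * (f n x : R)| <= 3^-1 ^+ n * `|x|.
    by rewrite normrM gtr0_norm// ler_wpM2l// ltW.
  rewrite /= /step; case: ifPn => _; [rewrite dualD|rewrite dualB];
    by rewrite dualZ addrAC subrr add0r ?normrN.
have SB n k x : `|(S (n + k)%N x : R) - S n x| <= 3 / 2 * 3^-1 ^+ n * `|x|.
  have : `|(S (n + k)%N x : R) - S n x| <=
      3 / 2 * (3^-1 ^+ n - 3^-1 ^+ (n + k)) * `|x|.
    elim: k => [|k ih]; first by rewrite addn0 !subrr normr0 mulr0 mul0r.
    have := SS (n + k)%N x; rewrite addnS.
    have := ler_distD (S (n + k)%N x : R) (S (n + k).+1 x) (S n x).
    by rewrite exprS; lra.
  move/le_trans; apply; rewrite ler_wpM2r// ler_wpM2l ?divr_ge0//.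
  by rewrite lerBlDr lerDl ltW.
have cS x : cvgn (fun n => S n x : R^o).
  pose u n : R^o := (S n.+1 x : R) - S n x.
  have -> : (fun n => S n x) = series u.
    apply/funext; elim=> [|n ih]; first by rewrite seriesEnat /= big_geq.
    by rewrite seriesSr -ih addrC subrK.
  apply: (@geometric_cvg_series _ _ _ `|x| 3^-1) => [|n].
    by rewrite invr_ge0 ler0n/= invf_lt1// ltr1n.
  by rewrite mulrC; exact: SS.
pose g x : R^o := limn (fun n => S n x : R^o).
have gS n x : `|(g x : R) - S n x| <= 3 / 2 * 3^-1 ^+ n * `|x|.
  have : `|(S m x : R) - S n x| @[m --> \oo] --> `|(g x : R) - S n x|.
    by apply: cvg_norm; apply: cvgB; [exact: cS|exact: cvg_cst].
  move/cvgr_to_le; apply; near=> m.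
  have nm : (n <= m)%N by near: m; exact: nbhs_infty_ge.
  by rewrite -(subnKC nm); exact: SB.
have lg : linear g.
  move=> a x y; apply: cvg_lim => //.
  rewrite (_ : (fun n => _) = fun n => a *: (S n x : R^o) + S n y); last first.
    by apply/funext => n; rewrite linearP.
  by apply: cvgD; [apply: cvgZr|]; exact: cS.
have gb x : `|g x| <= 3 / 2 * `|x|.
  by have := gS 0%N x; rewrite expr0 mulr1 /= subr0.
have [e eg] := exists_dual lg gb.
exists e => -[C eC].
have [n Cn] : exists n, C < n%:R by exists (Num.truncn C).+1; exact: truncnS_gt.
have [zr z1 Tz] := zP n.
have := eC _ zr; apply/negP; rewrite -ltNge eg.
have := gS n.+1 (z n); rewrite z1 mulr1 => gSn.
(* The tail after step [n] is at most [3 / 2 * 3^-1 ^+ n.+1], that is half of the lower bound [Sz].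
   With ratio [1 / 2] in place of [1 / 3] it could cancel all of it. *)
have gz : 3^-1 ^+ n / 2 <= `|g (z n) : R|.
  have := lerB_dist (S n.+1 (z n) : R) (g (z n)); have := Sz n.
  by move: gSn; rewrite distrC exprS; lra.
apply: lt_le_trans gz; have := normr_ge0 (T (z n)) => Tz0.
have Cn1 : C <= n.+1%:R by rewrite -natr1; lra.
apply: le_lt_trans (ler_wpM2r Tz0 Cn1) _.
rewrite mulrC -ltr_pdivlMr//; move: Tz.
by rewrite invfM mulrA.
Unshelve. all: by end_near. Qed.

End NotBoundedBelow.

Section Domination.
Variables (R : realType) (E F : completeNormedModType R) (T : {linear E -> F}).

Lemma dominated_on_lin (K : set E) a (f g : dual E) :
  dominated_on T K f -> dominated_on T K g -> dominated_on T K (a *: f + g).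
Proof.
move=> [C fC] [D gD]; exists (`|a| * C + D) => z Kz; rewrite dualD dualZ.
apply: le_trans (ler_normD _ _) _; rewrite mulrDl lerD ?gD//.
by rewrite normrM -mulrA ler_wpM2l// fC.
Qed.

Lemma common_kernel_rcons (rs : seq (dual E)) r z :
  common_kernel (rcons rs r) z <-> r z = 0 :> R /\ common_kernel rs z.
Proof.
rewrite -common_kernel_cons; split=> h q; move: (h q);
  by rewrite mem_rcons.
Qed.

(* The hypothesis on [rs] says that no nonzero combination of [rs] is of the form
   [phi \o T]. *)
Lemma undominated_extend (rs : seq (dual E)) f :
  (forall y e, 0 < e -> exists z, common_kernel rs (z - y) /\ `|T z| <= e) ->
  ~ dominated_on T (common_kernel rs) f ->
  forall y e, 0 < e ->
    exists z, common_kernel (rcons rs f) (z - y) /\ `|T z| <= e.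
Proof.
move=> rsT nf y e e0; have e2 : 0 < e / 2 by rewrite divr_gt0.
have [z [zr Tz]] := rsT y _ e2.
pose c : R := (f y : R) - f z.
(* Non-domination gives a [w] with [f w] so large compared to [T w] that the multiple of [w]
   repairing the value of [f] costs at most [e / 2] in the image. *)
move/forallNP : nf => /(_ (`|c| * (e / 2)^-1))/existsNP[w /not_implyP[wr]].
move=> /negP; rewrite -ltNge => fw.
have fw0 : (f w : R) != 0.
  rewrite -normr_gt0; apply: le_lt_trans fw; rewrite !mulr_ge0// invr_ge0.
  exact: ltW.
pose b := c / f w.
exists (z + b *: w); split.
  apply/common_kernel_rcons; split.
    rewrite dual_linearB dual_linearD dual_linearZ /b mulfVK// /c; lra.
  by rewrite addrAC addrC; exact: common_kernel_lin.
rewrite linearD linearZ /=; apply: le_trans (ler_normD _ _) _.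
rewrite [e in leRHS]splitr lerD// normrZ /b normrM normfV.
rewrite mulrAC ler_pdivrMr ?normr_gt0// -ler_pdivrMl//.
by rewrite mulrA (mulrC _ `|c|) ltW.
Qed.

End Domination.

Section Functional.
Variables (R : realType) (E G F : completeNormedModType R).
Variables (A : {linear G -> E}) (T : {linear E -> F}).
Hypotheses (bA : bounded_op A) (dA : dense (range A)) (AnT : range A <> setT).
Hypotheses (bT : bounded_op T) (dT : dense (range T)) (TnT : range T <> setT).

(** Start from a functional undominated on the smaller kernel of [rs ++ rs']; making it vanish on
    [V] leaves it unchanged there. *)
Lemma admissible_not_dominated V rs : admissible A V ->
  exists2 h, annihilator V h & ~ dominated_on T (common_kernel rs) h.
Proof.
move=> /admissible_finite_codim[rs' rsP].
have [e ne] := exists_not_dominated bT dT TnT (rs ++ rs').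
have [h hV he] := rsP e; exists h => // -[C hC]; apply: ne; exists C => z zr.
rewrite -he; last by move=> r rr; apply: zr; rewrite mem_cat rr orbT.
by apply: hC => r rr; apply: zr; rewrite mem_cat rr.
Qed.

(** The functional is [d *: q + h]: [q] follows [g] along [A], while [h], tiny along [A] but at
    least 1 at [x], keeps the value at [x] away from 0 however small [d] is. *)
Lemma exists_functional V rs (g : dual E) e e2 M :
  admissible A V -> 0 < e -> 0 < e2 -> 0 < M ->
  exists (f : dual E) (d : R) (x : E),
    [/\ annihilator V f, ~ dominated_on T (common_kernel rs) f,
        `|x| <= 1 /\ 2^-1 <= f x,
        0 < d /\ forall a, `|(f (A a) : R) - d * g (A a)| <= d * e * `|a| &
        forall a, `|f (A a)| * M <= e2 * `|a|].
Proof.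
move=> aV e0 e20 M0.
have [p pV pg] := admissible_approx g aV (divr_gt0 e0 (ltr0n R 4)).
have [h1 h1V nh1] := admissible_not_dominated rs aV.
have [Bp Bp0 pB] := dual_bounded p.
have [B1 B10 h1B] := dual_bounded h1.
have [BA BA0 AB] : exists2 BA, 0 < BA & forall a, `|A a| <= BA * `|a|.
  have [B AB] := bA; exists (`|B| + 1) => [|a]; first by rewrite ltr_wpDl.
  apply: le_trans (AB a) _; rewrite ler_wpM2r//.
  by have := ler_norm B; lra.
have B1A : 0 < B1 * BA by rewrite mulr_gt0.
pose s1 := e / 4 / (B1 * BA).
have s10 : 0 < s1 by rewrite !divr_gt0.
have s1h a : `|s1 * (h1 (A a) : R)| <= e / 4 * `|a|.
  rewrite normrM gtr0_norm// /s1 mulrAC ler_pdivrMr// -[leRHS]mulrA ler_wpM2l//.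
    by rewrite divr_ge0// ltW.
  apply: le_trans (h1B _) _; rewrite [leRHS]mulrC -mulrA ler_pM2l//.
clearbody s1; pose p1 := p + s1 *: h1.
pose B := Bp + s1 * B1.
have B0 : 0 < B by rewrite addr_gt0// mulr_gt0.
have p1B y : `|p1 y| <= B * `|y|.
  rewrite dualD dualZ; apply: le_trans (ler_normD _ _) _.
  rewrite mulrDl lerD// normrM gtr0_norm// -mulrA ler_pM2l//.
have {}pB y : `|p y| <= B * `|y|.
  by apply: le_trans (pB y) _; rewrite ler_wpM2r// lerDl ltW// mulr_gt0.
have p1V : annihilator V p1.
  move=> x Vx; have := annihilator0 pV Vx; have := annihilator0 h1V Vx.
  by rewrite dualD dualZ => -> ->; rewrite mulr0 addr0.
have p1g a : `|(p1 (A a) : R) - g (A a)| <= e / 2 * `|a|.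
  rewrite dualD dualZ addrAC; apply: le_trans (ler_normD _ _) _.
  by have := pg a; have := s1h a; lra.
have {}pg a : `|(p (A a) : R) - g (A a)| <= e / 2 * `|a|.
  by apply: le_trans (pg a) _; rewrite ler_wpM2r//; lra.
(* The first bound limits [d * q x] to [1 / 2]; the second leaves half of the allowance [e2] for
   [h]. *)
pose d := Num.min (1 / (2 * B)) (e2 / (2 * (M * (B * BA)))).
have MB : 0 < M * (B * BA) by rewrite !mulr_gt0.
have d0 : 0 < d by rewrite lt_min !divr_gt0// mulr_gt0.
have dB : d * (2 * B) <= 1.
  by rewrite -ler_pdivlMr ?mulr_gt0// ge_min lexx.
have dM : d * (2 * (M * (B * BA))) <= e2.
  by rewrite -ler_pdivlMr ?mulr_gt0// ge_min lexx orbT.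
(* The tolerance for [h] comes after [d], because the approximation error is measured relative to
   [d]. *)
clearbody d; pose n := Num.min (d * e / 2) (e2 / (2 * M)).
have n0 : 0 < n by rewrite lt_min !divr_gt0 ?mulr_gt0.
have nd : n <= d * e / 2 by rewrite ge_min lexx.
have nM : n * (2 * M) <= e2.
  by rewrite -ler_pdivlMr ?mulr_gt0// ge_min lexx orbT.
clearbody n; have [Bh uV] := admissible_unnorming bA dA AnT aV.
have [h [x [hV [x1 hx] _ hA]]] := uV _ n0.
have [q [qV nq qB qg]] : exists q : dual E, [/\ annihilator V q,
    ~ dominated_on T (common_kernel rs) (d *: q + h),
    forall y, `|q y| <= B * `|y| &
    forall a, `|(q (A a) : R) - g (A a)| <= e / 2 * `|a|].
  (* [p] and [p1] approximate [g] equally well, and their difference is not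
     dominated, so at most one of the two choices can fail *)
  have [dp|] := pselect (dominated_on T (common_kernel rs) (d *: p + h)).
    exists p1; split=> // dp1; apply: nh1.
    have -> : h1 = (d * s1)^-1 *: ((-1) *: (d *: p + h) + (d *: p1 + h)) + 0.
      rewrite addr0 scaleN1r [X in _ *: X]addrC opprD addrACA subrr addr0.
      rewrite -scalerBr /p1 addrAC subrr add0r (scalerA d) scalerA mulVf ?scale1r//.
      by rewrite gt_eqF// mulr_gt0.
    apply: dominated_on_lin; first exact: dominated_on_lin.
    by exists 0 => z _; rewrite normr0 mul0r.
  by exists p.
exists (d *: q + h), d, x; split=> //.
- move=> y Vy; have := annihilator0 qV Vy; have := annihilator0 hV Vy.
  by rewrite dualD dualZ => -> ->; rewrite mulr0 addr0.
- split=> //; rewrite dualD dualZ.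
  have : `|d * (q x : R)| <= d * B.
    rewrite normrM gtr0_norm// ler_pM2l//; apply: le_trans (qB x) _.
    by rewrite ler_piMr// ltW.
  by rewrite ler_norml => /andP[? _]; lra.
- split=> // a; rewrite dualD dualZ addrAC -mulrBr.
  apply: le_trans (ler_normD _ _) _; rewrite normrM gtr0_norm//.
  have : d * `|(q (A a) : R) - g (A a)| <= d * (e / 2 * `|a|) by rewrite ler_pM2l.
  have : n * `|a| <= d * e / 2 * `|a| by rewrite ler_wpM2r.
  by have := hA a; lra.
- move=> a; rewrite dualD dualZ.
  have qa : `|d * (q (A a) : R)| <= d * (B * BA) * `|a|.
    rewrite normrM gtr0_norm// -!mulrA ler_pM2l//; apply: le_trans (qB _) _.
    by rewrite ler_pM2l.
  have : `|d * (q (A a) : R) + h (A a)| <= (d * (B * BA) + n) * `|a|.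
    by apply: le_trans (ler_normD _ _) _; rewrite mulrDl lerD.
  move=> /(ler_wpM2r (ltW M0))/le_trans; apply.
  by rewrite mulrAC ler_wpM2r//; lra.
Qed.

End Functional.

(** * The inductive construction *)

Section Chain.
Variables (S : Type) (ok : seq S -> S -> Prop).

Inductive chain : seq S -> Prop :=
| chain_nil : chain [::]
| chain_rcons s t : chain s -> ok s t -> chain (rcons s t).

(** Dependent choice in which every step sees the whole history. *)
Lemma chain_sequence : (forall s, chain s -> exists t, ok s t) ->
  exists u : nat -> S, forall n, chain (mkseq u n) /\ ok (mkseq u n) (u n).
Proof.
move=> ext.
have /choice[next nextP] : forall s, exists t, chain s -> ok s t.
  move=> s; have [cs|ncs] := pselect (chain s).
    by have [t st] := ext _ cs; exists t.
  by have [t _] := ext _ chain_nil; exists t.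
pose h := fix h n := if n is m.+1 then rcons (h m) (next (h m)) else [::].
have hE n : h n = mkseq (fun m => next (h m)) n.
  elim: n => [//|n IH].
  by rewrite mkseqS -IH.
have ch n : chain (h n).
  elim: n => [|n IH]; first exact: chain_nil.
  by apply: chain_rcons => //; exact: nextP.
exists (fun m => next (h m)) => n; rewrite -hE; split=> //; exact: nextP.
Qed.

End Chain.

Section Construction.
Variables (R : realType) (E G F : completeNormedModType R).
Variables (A : {linear G -> E}) (T : {linear E -> F}).
Hypotheses (bA : bounded_op A) (dA : dense (range A)) (AnT : range A <> setT).
Hypotheses (bT : bounded_op T) (dT : dense (range T)) (TnT : range T <> setT).
Variables (g : nat -> dual E) (tau : nat -> nat).

(* a functional f_n, its biorthogonal vector x_n and the vector z_n *)
Let state : Type := dual E * E * E.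

Let funs (s : seq state) : seq (dual E) := [seq t.1.1 | t <- s].
Let vecs (s : seq state) : set E :=
  [set v | exists2 t, t \in s & v = t.1.2 \/ v = t.2].

(** The two non-smallness fields keep [vecs] admissible. [step_corrector] concerns the functionals
    up to the present one; [step_ann] at later steps takes care of the others. The list in
    [step_corrector] includes the new vector, as [tau n = n] may occur. *)
Record step_ok (s : seq state) (t : state) : Prop := StepOk {
  step_ann : annihilator (vecs s) t.1.1;
  step_one : t.1.1 t.1.2 = 1 :> R;
  step_ker : common_kernel (funs s) t.1.2;
  step_not_small1 : ~ small A (vecs s) t.1.2;
  step_not_small2 : ~ small A (vecs s `|` [set t.1.2]) t.2;
  step_undominated : ~ dominated_on T (common_kernel (funs s)) t.1.1;
  step_corrector : common_kernel (rcons (funs s) t.1.1)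
    (t.2 - nth 0 (rcons [seq t'.1.2 | t' <- s] t.1.2) (tau (size s)));
  step_small_image : `|T t.2| <= (size s).+1%:R^-1;
  step_summable : forall a,
    `|t.1.1 (A a)| * `|t.1.2| <= 2^-1 ^+ size s * `|a|;
  step_approx : exists2 d : R, 0 < d & forall a,
    `|(t.1.1 (A a) : R) - d * g (tau (size s)) (A a)|
      <= d * (size s).+1%:R^-1 * `|a| }.

Let vecs_rcons s t :
  vecs (rcons s t) = vecs s `|` [set t.1.2] `|` [set t.2].
Proof.
apply/seteqP; split=> v.
  move=> [t']; rewrite mem_rcons in_cons => /orP[/eqP ->|t's] vt'.
    by case: vt' => ->; [left; right|right].
  by left; left; exists t'.
move=> [[[t' t's vt']|->]|->];
  [exists t'|exists t; last by left|exists t; last by right] => //.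
- by rewrite mem_rcons in_cons t's orbT.
- by rewrite mem_rcons mem_head.
- by rewrite mem_rcons mem_head.
Qed.

Let funs_rcons s t : funs (rcons s t) = rcons (funs s) t.1.1.
Proof. by rewrite /funs map_rcons. Qed.

Let chain_admissible s : chain step_ok s -> admissible A (vecs s).
Proof.
elim=> {s} [|s t _ IH st].
  rewrite (_ : vecs [::] = set0); first exact: admissible0.
  by apply/seteqP; split=> // v [t]; rewrite in_nil.
rewrite vecs_rcons; apply: admissibleU; last exact: step_not_small2 st.
by apply: admissibleU => //; exact: step_not_small1 st.
Qed.

Let chain_corrector s : chain step_ok s -> forall y e, 0 < e ->
  exists z, common_kernel (funs s) (z - y) /\ `|T z| <= e.
Proof.
elim=> {s} [|s t _ IH st] y e e0.
  by exists 0; split; [rewrite common_kernel_nil|rewrite linear0 normr0 ltW].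
rewrite funs_rcons; apply: undominated_extend => //.
exact: step_undominated st.
Qed.

(** Subtracting the components along the biorthogonal vectors projects onto the common kernel, and
    functionals vanishing on [vecs s] do not notice. *)
Let chain_proj s : chain step_ok s -> exists2 C : R, 0 < C & forall y,
  exists y', [/\ common_kernel (funs s) y', `|y'| <= C * `|y| &
    forall h, annihilator (vecs s) h -> h y' = h y :> R].
Proof.
elim=> {s} [|s t _ [C C0 IH] st].
  by exists 1 => // y; exists y; rewrite mul1r common_kernel_nil.
have [B B0 fB] := dual_bounded t.1.1.
exists (C * (1 + B * `|t.1.2|)) => [|y].
  by rewrite mulr_gt0// ltr_wpDr// mulr_ge0// ltW.
have [y' [ky' ny' hy']] := IH y.
exists (y' - t.1.1 y' *: t.1.2); split.
- rewrite funs_rcons; apply/common_kernel_rcons; split.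
    by rewrite dual_linearB dual_linearZ (step_one st) mulr1 subrr.
  by rewrite addrC -scaleNr; apply: common_kernel_lin => //; exact: step_ker st.
- apply: le_trans (ler_normB _ _) _; rewrite normrZ.
  have := ler_wpM2r (normr_ge0 t.1.2) (fB y').
  have : B * `|t.1.2| * `|y'| <= B * `|t.1.2| * (C * `|y|).
    by rewrite ler_wpM2l// mulr_ge0// ltW.
  lra.
- move=> h; rewrite vecs_rcons => /annihilatorU[/annihilatorU[hs h1] _].
  by rewrite dual_linearB dual_linearZ h1 mulr0 subr0 hy'.
Qed.

Lemma chain_extend s : chain step_ok s -> exists t, step_ok s t.
Proof.
move=> cs; have aV := chain_admissible cs.
have [C C0 CP] := chain_proj cs.
pose n := (size s).+1%:R^-1 : R.
have n0 : 0 < n by rewrite invr_gt0.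
have e20 : 0 < (2^-1 : R) ^+ size s by rewrite exprn_gt0// invr_gt0.
(* [2 * C + 1] bounds the norm of the coming biorthogonal vector before [f] is chosen, so [f] can be
   taken small enough for [step_summable]. *)
have M0 : 0 < 2 * C + 1 by rewrite addr_gt0// mulr_gt0.
have [f [d [x [fV nf [x1 fx] [d0 fg] fA]]]] :=
  exists_functional bA dA AnT bT dT TnT (funs s) (g (tau (size s))) aV n0 e20 M0.
have [x' [kx' nx' /(_ _ fV) fx']] := CP x.
have fx'0 : 0 < (f x' : R) by rewrite fx' (lt_le_trans _ fx)// invr_gt0.
pose x0 := (f x' : R)^-1 *: x'.
have fx0 : f x0 = 1 :> R by rewrite dual_linearZ mulVf// gt_eqF.
have kx0 : common_kernel (funs s) x0.
  by move=> r rs; rewrite dual_linearZ (kx' r)// mulr0.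
have nx0 : `|x0| <= 2 * C.
  rewrite normrZ normfV gtr0_norm// ler_pdivrMl//; apply: le_trans nx' _.
  apply: (@le_trans _ _ C); first by rewrite ler_piMr// ltW.
  by rewrite fx'; nra.
clearbody x0.
have [x2 [kx2 fx2 sx2 nx2]] : exists x2, [/\ common_kernel (funs s) x2,
    f x2 = 1 :> R, ~ small A (vecs s) x2 & `|x2| <= 2 * C + 1].
  (* If [x0] is small, add a non-small vector of norm at most 1 killed by [f] and by its
     predecessors. Small vectors form a subspace, so the sum is not small. *)
  have [sx0|nsx0] := pselect (small A (vecs s) x0); last first.
    by exists x0; split=> //; lra.
  have [y ny] := admissible_not_small bA dA AnT aV.
  have [y1 [ky1 _ hy1]] := CP y.
  pose y2 := - (f y1 : R) *: x0 + y1.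
  have fy2 : f y2 = 0 :> R by rewrite dual_linearD dual_linearZ fx0; lra.
  have ky2 : common_kernel (funs s) y2 by exact: common_kernel_lin.
  have ny2 : ~ small A (vecs s) y2.
    move=> sy2; apply: ny.
    have [D DP] := small_lin (f y1 : R) sx0 sy2; exists D => h hV hA.
    by have := DP h hV hA; rewrite /y2 addrA scaleNr subrr add0r hy1.
  clearbody y2; have k0 : 0 < (`|y2| + 1)^-1 by rewrite invr_gt0 ltr_wpDl.
  exists ((`|y2| + 1)^-1 *: y2 + x0); split.
  - exact: common_kernel_lin.
  - by rewrite dual_linearD dual_linearZ fy2 mulr0 add0r.
  - move=> sx; apply: ny2.
    have := small_lin (`|y2| + 1) (small_lin (-1) sx0 sx) (small_lin (-1) sx0 sx0).
    rewrite scaleN1r (addrC _ x0) addKr addNr addr0 scalerA mulfV ?scale1r//.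
    by rewrite -invr_eq0 gt_eqF.
  - have : `|(`|y2| + 1)^-1 *: y2| <= 1.
      rewrite normrZ gtr0_norm// -[leRHS](mulVf (_ : `|y2| + 1 != 0)).
        by rewrite ler_pM2l// lerDl.
      by rewrite -invr_eq0 gt_eqF.
    by have := ler_normD ((`|y2| + 1)^-1 *: y2) x0; lra.
have aV1 : admissible A (vecs s `|` [set x2]) by exact: admissibleU.
pose w := nth 0 (rcons [seq t.1.2 | t <- s] x2) (tau (size s)).
have n20 : 0 < n / 2 by rewrite divr_gt0.
have [z0 [kz0 Tz0]] := undominated_extend (chain_corrector cs) nf w n20.
have [z [kz sz Tz]] : exists z, [/\ common_kernel (rcons (funs s) f) (z - w),
    ~ small A (vecs s `|` [set x2]) z & `|T z| <= n].
  (* The same perturbation, scaled so that its image under [T] is at most [n / 2]. *)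
  have [sz0|nsz0] := pselect (small A (vecs s `|` [set x2]) z0); last first.
    by exists z0; split=> //; lra.
  have [y ny] := admissible_not_small bA dA AnT aV1.
  have [y1 [ky1 _ hy1]] := CP y.
  pose y2 := - (f y1 : R) *: x2 + y1.
  have ky2 : common_kernel (rcons (funs s) f) y2.
    apply/common_kernel_rcons; split; last exact: common_kernel_lin.
    by rewrite dual_linearD dual_linearZ fx2; lra.
  have ny2 : ~ small A (vecs s `|` [set x2]) y2.
    move=> [D DP]; apply: ny; exists D => h hV hA.
    have [hs hx2] := (annihilatorU _ _ _).1 hV.
    by have := DP h hV hA; rewrite dual_linearD dual_linearZ hx2 mulr0 add0r hy1.
  clearbody y2; pose k := n / 2 / (`|T y2| + 1).
  have k0 : 0 < k by rewrite divr_gt0// ltr_wpDl.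
  exists (k *: y2 + z0); split.
  - by rewrite -addrA; exact: common_kernel_lin.
  - move=> sx; apply: ny2.
    have := small_lin k^-1 (small_lin (-1) sz0 sx) (small_lin (-1) sz0 sz0).
    rewrite scaleN1r (addrC _ z0) addKr addNr addr0 scalerA mulVf ?scale1r//.
    by rewrite gt_eqF.
  - rewrite linearD linearZ /=; apply: le_trans (ler_normD _ _) _.
    rewrite [leRHS]splitr lerD// normrZ gtr0_norm// mulrC ler_mul_shrink//.
    exact: ltW.
exists (f, x2, z); split=> //= [a|]; last by exists d.
by apply: le_trans (fA a); rewrite ler_wpM2l.
Qed.

Lemma biorthogonal_construction : (forall n, (tau n <= n)%N) ->
  exists (f : nat -> dual E) (x z : nat -> E),
  [/\ forall i j, f i (x j) = (i == j)%:R :> R,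
      forall i k, f i (z k) = (i == tau k)%:R :> R,
      forall k, `|T (z k)| <= k.+1%:R^-1,
      forall k a, `|f k (A a)| * `|x k| <= 2^-1 ^+ k * `|a| &
      forall k, exists2 d : R, 0 < d & forall a,
        `|(f k (A a) : R) - d * g (tau k) (A a)| <= d * k.+1%:R^-1 * `|a|].
Proof.
move=> tau_le; have [u uP] := chain_sequence chain_extend.
pose f n := (u n).1.1; pose x n := (u n).1.2; pose z n := (u n).2.
have uin m n : (m < n)%N -> u m \in mkseq u n.
  by move=> mn; apply: map_f; rewrite mem_iota.
have uvec m n : (m < n)%N -> vecs (mkseq u n) (x m) /\ vecs (mkseq u n) (z m).
  by move=> /uin mn; split; exists (u m) => //; [left|right].
have ufun m n : (m < n)%N -> f m \in funs (mkseq u n).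
  by move=> /uin; exact: (map_f (fun t : state => t.1.1)).
have fx i j : f i (x j) = (i == j)%:R :> R.
  have [ij|ji|<-] := ltngtP i j.
  - by have [_ /step_ker] := uP j; apply; exact: ufun.
  - have [_ /step_ann fi] := uP i.
    by apply: (annihilator0 fi); have [] := uvec _ _ ji.
  - by have [_ /step_one] := uP i.
exists f, x, z; split=> //.
(* For [k < i] both sides are 0: [f i] annihilates the earlier [z k], and [tau k <= k < i]. *)
- move=> i k; have [ik|ki] := leqP i k; last first.
    have [_ /step_ann fi] := uP i.
    rewrite (annihilator0 fi); last by have [] := uvec _ _ ki.
    by rewrite gtn_eqF// (leq_ltn_trans (tau_le k)).
  have [_ /step_corrector] := uP k; rewrite size_mkseq => kk.
  have := kk (f i); rewrite mem_rcons in_cons.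
  have -> : (f i == (u k).1.1) || (f i \in funs (mkseq u k)).
    by move: ik; rewrite leq_eqVlt => /predU1P[->|/ufun ->]; rewrite ?eqxx ?orbT.
  move=> /(_ isT); rewrite dual_linearB => /subr0_eq ->.
  rewrite nth_rcons size_map size_mkseq; have := tau_le k.
  rewrite leq_eqVlt => /predU1P[->|tk]; first by rewrite ltnn eqxx fx.
  by rewrite tk (nth_map (u 0%N)) ?size_mkseq// nth_mkseq// fx.
- by move=> k; have [_ /step_small_image] := uP k; rewrite size_mkseq.
- by move=> k; have [_ /step_summable] := uP k; rewrite size_mkseq.
- by move=> k; have [_ /step_approx] := uP k; rewrite size_mkseq.
Qed.

End Construction.

(** * The quotient by the common kernel *)

Section SeparabilityTools.
Variable R : realType.

Lemma eq0_frequently_le (C r : R) :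
  (forall m, exists2 k, (m <= k)%N & `|r| <= C * k.+1%:R^-1) -> r = 0.
Proof.
move=> rC; apply/eqP/negPn/negP; rewrite -normr_gt0 => r0.
have [k mk] := rC (Num.truncn (C / `|r|)).+1.
rewrite ler_pdivlMr// leNgt => /negP; apply.
rewrite mulrC -ltr_pdivrMr//; apply: lt_le_trans (truncnS_gt _) _.
by rewrite ler_nat ltnW// ltnS.
Qed.

(** The 2-adic valuation of [k.+1] thus serves as a schedule returning to every index infinitely
    often; the witness has [k.+1 = 2 ^ n * (2 * m + 1)]. *)
Lemma logn2_frequently n m : exists2 k, (m <= k)%N & logn 2 k.+1 = n.
Proof.
have p2 : (0 < 2 ^ n)%N by rewrite expn_gt0.
have k0 : (0 < 2 ^ n * m.*2.+1)%N by rewrite muln_gt0 p2.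
exists (2 ^ n * m.*2.+1).-1; last first.
  rewrite prednK// lognM// pfactorK// logn_coprime ?addn0//.
  by rewrite coprime2n /= odd_double.
rewrite -ltnS prednK// (leq_trans _ (leq_pmull _ p2))// ltnS -addnn leq_addr//.
Qed.

(** Evaluation at a nonzero [x] is weak*-continuous and somewhere nonzero, hence nonzero at a point
    of the countable dense set. *)
Lemma weak_star_total (E : normedModType R) : separable (weak_star E) ->
  exists g : nat -> dual E, forall x, (forall n, g n x = 0 :> R) -> x = 0.
Proof.
move=> [D /countable_injP[c cinj] dD].
(* An index that codes no element of [D] gets the zero functional. *)
have /choice[g gP] : forall n, exists d : dual E, forall d', D d' -> c d' = n -> d' = d.
  move=> n; have [[d [Dd cd]]|nd] := pselect (exists d, D d /\ c d = n).
    by exists d => d' Dd' cd'; apply: cinj; rewrite ?mem_set// cd.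
  by exists 0 => d' Dd' cd'; exfalso; apply: nd; exists d'.
exists g => x gx; apply: contrapT => /eqP x0.
pose ev (f : weak_star E) : R^o := (f : dual E) x.
have cev : continuous ev.
  move=> f; apply: (@continuous_comp _ _ _
    (fun h : weak_star E => dual_fun h : {ptws E -> R^o}) (fun h => h x)).
    exact: initial_continuous.
  exact: (@proj_continuous E (fun=> R^o) x).
have [f [_ fx]] := norming_dual x.
have [d [dx Dd]] : (ev @^-1` [set r | r != 0]) `&` D !=set0.
  apply: dD; first by exists f; rewrite /= /ev fx normr_eq0.
  by apply: open_comp; [move=> h _; exact: cev|exact: open_neq].
have dg := gP (c d) d Dd erefl.
by move/eqP: dx; apply; rewrite /ev dg gx.
Qed.

Lemma rational_combination (E : normedModType R) (x : nat -> E) (c : nat -> R)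
    n e : 0 < e -> exists q : seq rat,
  `|\sum_(i < n) c i *: x i - \sum_(i < size q) ratr q`_i *: x i| < e.
Proof.
move=> e0.
(* Division by [n.+1] keeps the total of [n] errors strictly below [e], also for the empty sum. *)
have /choice[q qP] : forall i, exists q : rat,
    `|(c i - ratr q) *: x i| < e / n.+1%:R.
  move=> i; pose d := e / n.+1%:R / (`|x i| + 1).
  have d0 : 0 < d by rewrite !divr_gt0// ltr_wpDl.
  have [|q] := @rat_in_itvoo R (c i - d) (c i + d); first by lra.
  rewrite in_itv/= => /andP[cq qc]; exists q; rewrite normrZ.
  have cqd : `|c i - ratr q| < d by rewrite ltr_norml; lra.
  have [->|x0] := eqVneq `|x i| 0; first by rewrite mulr0 divr_gt0.
  have xi0 : 0 < `|x i| by rewrite lt_neqAle eq_sym x0 normr_ge0.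
  apply: (@lt_le_trans _ _ (d * `|x i|)); first by rewrite ltr_pM2r.
  by rewrite mulrC ler_mul_shrink// divr_ge0// ltW.
exists (mkseq q n); rewrite size_mkseq.
rewrite [X in _ - X](eq_bigr (fun i : 'I_n => ratr (q i) *: x i)); last first.
  by move=> i _; rewrite nth_mkseq.
rewrite -sumrB; under eq_bigr do rewrite -scalerBl.
apply: le_lt_trans (ler_norm_sum _ _ _) _.
apply: (@le_lt_trans _ _ (\sum_(i < n) e / n.+1%:R)).
  by apply: ler_sum => i _; exact: ltW.
rewrite sumr_const card_ord -[_ *+ n]mulr_natr -mulrA gtr_pMr// mulrC ltr_pdivrMr//.
by rewrite mul1r ltr_nat.
Qed.

End SeparabilityTools.

Section CommonKernelQuotient.
Variables (R : realType) (E : normedModType R) (f : nat -> dual E).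

Fact sequence_kernel_submod : submod_closed (mem [set x | forall n, f n x = 0 :> R]).
Proof.
split=> [|a x y /set_mem fx /set_mem fy]; apply/mem_set => n.
  exact: dual_linear0.
by rewrite dual_linearD dual_linearZ fx fy mulr0 addr0.
Qed.

Fact sequence_kernel_closed : closed [set x | forall n, f n x = 0 :> R].
Proof.
rewrite (_ : [set x | _] = \bigcap_n ((f n : E -> R^o) @^-1` [set 0])).
  apply: closed_bigI => n _; apply: (continuous_closedP _).1.
    exact: dual_continuous.
  exact: closed_eq.
by apply/seteqP; split=> x fx n; [move=> _; exact: fx|exact: fx].
Qed.

Definition sequence_kernel : closedSubspace E :=
  ClosedSubspace sequence_kernel_submod sequence_kernel_closed.

(** If [n] classes spanned, some nontrivial combination of [n.+1] of the [x i] would lie in the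
    kernel, yet each [f j] reads off its coefficient. *)
Lemma biorthogonal_infinite_dimensional (x : nat -> E) :
  (forall i j, f i (x j) = (i == j)%:R :> R) ->
  infinite_dimensional (quotientSpace sequence_kernel).
Proof.
move=> fx [n [b bP]].
pose pi := \pi_(quotientSpace sequence_kernel)%qT : E -> quotientSpace sequence_kernel.
have /choice[c cP] := fun i : 'I_n.+1 => bP (pi (x i)).
pose M := \matrix_(i, j) c i j.
have /rowV0Pn[v /sub_kermxP vM /eqP v0] : kermx M != 0.
  by rewrite -mxrank_eq0 mxrank_ker subn_eq0 -ltnNge ltnS rank_leq_col.
apply: v0; apply/rowP => j; rewrite mxE.
have : pi (\sum_i v 0 i *: x i) = pi 0.
  rewrite (big_morph pi (id1 := 0) (op1 := +%R)); last 2 first.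
  - exact: pi_quotientD.
  - exact: pi_quotient0.
  rewrite /pi pi_quotient0.
  under eq_bigr do rewrite pi_quotientZ -/pi cP scaler_sumr.
  rewrite exchange_big /= big1// => k _.
  under eq_bigr do rewrite scalerA; rewrite -scaler_suml.
  have /rowP/(_ k) := vM; rewrite !mxE => vMk.
  rewrite (eq_bigr (fun i => v 0 i * M i k)) ?vMk ?scale0r//.
  by move=> i _; rewrite mxE.
move=> /quotientSpace_eqP/asboolP; rewrite subr0 => /(_ j).
rewrite linear_sum /= (bigD1 j)//= big1 => [|i ij].
  by rewrite addr0 dual_linearZ fx eqxx mulr1.
by rewrite dual_linearZ fx eq_sym val_eqE (negbTE ij) mulr0.
Qed.

Lemma quotient_separable (x : nat -> E) :
  (forall y e, 0 < e -> exists (n : nat) (c : nat -> R) (w : E),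
     (forall k, f k w = 0 :> R) /\ `|y - w - \sum_(i < n) c i *: x i| < e) ->
  separable (quotientSpace sequence_kernel).
Proof.
move=> xP.
pose pi := \pi_(quotientSpace sequence_kernel)%qT : E -> quotientSpace sequence_kernel.
pose h (q : seq rat) := pi (\sum_(i < size q) ratr q`_i *: x i).
exists (range h).
  exact: card_le_trans (card_image_le h setT) (countableP _).
move=> O [y0 Oy0] oO.
have /nbhs_ballP[e /= e0 eO] : nbhs y0 O by exact: open_nbhs_nbhs.
pose y := repr y0.
have yE : pi y = y0 by rewrite /pi reprK.
have e2 : 0 < e / 2 by rewrite divr_gt0.
have [n [c [w [fw yw]]]] := xP y _ e2.
have [q cq] := rational_combination x c n e2.
exists (h q); split; last by exists q.
apply: eO; rewrite -ball_normE /= -yE /h.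
set v := \sum_(i < size q) _ in cq *.
have -> : pi y - pi v = pi (y - w - v).
  rewrite /pi -scaleN1r -pi_quotientZ -pi_quotientD scaleN1r.
  apply/quotientSpace_eqP/asboolP => k.
  by rewrite (_ : _ - _ = w)// opprB addrA subrK opprB addrC subrK.
have ple t : `|pi t| <= `|t| by exact: quotient_norm_le.
apply: le_lt_trans (ple _) _.
set u := \sum_(i < n) _ in yw cq.
have -> : y - w - v = (y - w - u) + (u - v) by rewrite addrA subrK.
by apply: le_lt_trans (ler_normD _ _) _; lra.
Qed.

End CommonKernelQuotient.

Theorem corollary4p11 (R : realType) (E : completeNormedModType R)
    (hE : has_separable_quotient E)
    (hdual : separable (weak_star E))
    (S : set E) (hS : proper_dense_operator_range S)
    (F : completeNormedModType R)
    (T : {linear E -> F}) (bT : bounded_op T) (hT : proper_dense_range T) :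
  exists X : closedSubspace E,
    [/\ infinite_dimensional (quotientSpace X),
        separable (quotientSpace X),
        S `&` X = [set 0] &
        range (adjoint bT) `&` annihilator X = [set 0]].
Proof.
have [[G [A [bA AS]]] SnT dS] := hS; have [TnT dT] := hT.
have dA : dense (range A) by rewrite AS.
have AnT : range A <> setT by rewrite AS.
have [g gP] := weak_star_total hdual.
pose tau n := logn 2 n.+1.
have tau_le n : (tau n <= n)%N by rewrite -ltnS ltn_logl.
have [f [x [z [fx fz Tz fA fg]]]] :=
  biorthogonal_construction bA dA AnT bT dT TnT g tau_le.
have fC a k : `|f k (A a) *: x k| <= `|a| * 2^-1 ^+ k.
  by rewrite normrZ mulrC -[leRHS]mulrC [leLHS]mulrC; exact: fA.
(* This splits [A a] into [A a - s], which lies in the common kernel, and a limit [s] of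
   combinations of the [x i]. *)
have AX a : exists s,
    (\sum_(i < n) f i (A a) *: x i @[n --> \oo] --> s) /\
    (forall k, f k (A a - s) = 0 :> R).
  pose u n := f n (A a) *: x n.
  have uE : (fun n => \sum_(i < n) f i (A a) *: x i) = series u.
    by apply/funext => n; rewrite seriesEord.
  have cu : cvgn (series u).
    apply: (@geometric_cvg_series _ _ _ `|a| 2^-1); last exact: fC.
    by rewrite invr_ge0 ler0n/= invf_lt1// ltr1n.
  exists (limn (series u)); split=> [|k]; first by rewrite uE.
  rewrite dual_linearB; apply/eqP; rewrite subr_eq0; apply/eqP.
  have h1 : (f k (series u n) : R^o) @[n --> \oo] --> f k (limn (series u)).
    exact: (continuous_cvg _ (@dual_continuous _ _ (f k) _)).
  have h2 : (f k (series u n) : R^o) @[n --> \oo] --> f k (A a).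
    (* Once [n] exceeds [k], biorthogonality makes the value of [f k] on the partial sum equal to
       [f k (A a)]. *)
    apply: cvg_near_cst; near=> n.
    have kn : (k < n)%N by near: n; exact: nbhs_infty_gt.
    rewrite -uE linear_sum /= (bigD1 (Ordinal kn))//= big1 => [|i ik].
      by rewrite addr0 dual_linearZ fx eqxx mulr1.
    by rewrite dual_linearZ fx eq_sym; move: ik; rewrite -val_eqE /= => /negbTE ->;
      rewrite mulr0.
  exact: norm_cvg_unique h2 h1.
exists (sequence_kernel f); split.
- exact: (@biorthogonal_infinite_dimensional _ _ f x fx).
- apply: (@quotient_separable _ _ f x) => y e e0.
  have e2 : 0 < e / 2 by rewrite divr_gt0.
  have [_ [a _ <-] ya] := dense_approx y dA e2.
  have [s [sx sX]] := AX a.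
  have /cvgrPdist_lt/(_ _ e2)[n _ /(_ n (leqnn n)) /= ns] := sx.
  exists n, (fun i => f i (A a)), (A a - s); split=> //.
  set v := \sum_(i < n) _ in ns *.
  have -> : y - (A a - s) - v = (y - A a) + (s - v) by rewrite opprB addrA addrAC addrA.
  by apply: le_lt_trans (ler_normD _ _) _; lra.
- apply/seteqP; split=> [y []|_ ->]; last first.
    by split; [rewrite -AS; exists 0; rewrite ?linear0|move=> k; exact: dual_linear0].
  rewrite -AS => -[a _ <-] fAa; apply: gP => n.
  (* Since [f k] kills [A a], the estimate [fg] bounds [d * g n (A a)] by [d] times the norm of [a]
     over [k.+1] whenever [tau k = n], and [d] cancels. *)
  apply: (@eq0_frequently_le _ `|a|) => m.
  have [k mk tk] := logn2_frequently n m; exists k => //.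
  have [d d0 /(_ a)] := fg k.
  rewrite /tau tk (fAa k) sub0r normrN normrM gtr0_norm// -mulrA ler_pM2l//.
  by rewrite mulrC.
- apply/seteqP; split=> [_ [[phi _ <-] phiX]|_ ->]; last first.
    split; last by move=> y _.
    by exists 0 => //; apply: dualP.
  have [B B0 phiB] := dual_bounded phi.
  set psi := adjoint bT phi in phiX *.
  have psix j : psi (x j) = 0 :> R.
    (* Whenever [tau k = j], the vector [x j - z k] lies in the common kernel, so
       [psi (x j) = phi (T (z k))], which is at most [B / k.+1] in absolute value. *)
    apply: (@eq0_frequently_le _ B) => m.
    have [k mk tk] := logn2_frequently j m; exists k => //.
    have : psi (x j - z k) = 0 :> R.
      by apply: phiX => i; rewrite dual_linearB fx fz /tau tk subrr.
    rewrite dual_linearB => /subr0_eq ->.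
    apply: le_trans (phiB _) _; rewrite ler_pM2l//; exact: Tz.
  clearbody psi.
  (* Both parts of the splitting [AX] are killed: the first because [psi] annihilates the kernel,
     the second because [psi] is continuous and vanishes at every [x i]. *)
  have psiA a : psi (A a) = 0 :> R.
    have [s [sx sX]] := AX a.
    rewrite -(subrK s (A a)) dual_linearD [X in X + _](phiX _ sX) add0r.
    have h1 : (psi (\sum_(i < n) f i (A a) *: x i) : R^o) @[n --> \oo] --> psi s.
      exact: (continuous_cvg _ (@dual_continuous _ _ psi _)).
    have h2 : (psi (\sum_(i < n) f i (A a) *: x i) : R^o) @[n --> \oo] --> (0 : R^o).
      apply: cvg_near_cst; apply: nearW => n.
      by rewrite linear_sum /= big1// => i _; rewrite dual_linearZ psix mulr0.
    exact: norm_cvg_unique h1 h2.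
  apply: dualP => y; have [C C0 psiC] := dual_bounded psi.
  apply: (@eq0_frequently_le _ C) => m; exists m => //.
  have m0 : 0 < (m.+1%:R : R)^-1 by rewrite invr_gt0.
  have [_ [a _ <-] ya] := dense_approx y dA m0.
  have -> : psi y = psi (y - A a) :> R by rewrite dual_linearB psiA subr0.
  by apply: le_trans (psiC _) _; rewrite ler_pM2l// ltW.
Unshelve. all: by end_near. Qed.
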